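(* Let $\tau$ be a stopping time of $\{\mathcal{G}_t\}$ with $\mathbb{E}[\tau^2]<\infty$. Then $$\mathbb{E}\left[\sum_{i=1}^n\int_0^\tau\omega_iN_i(u)\,du\right]=\frac{1}{2\sum_{i=1}^n\omega_iD_i}\mathbb{E}\left[\Bigl(\sum_{i=1}^n\omega_iN_i(\tau)\Bigr)^2\right]-\frac{\sum_{i=1}^n\omega_i^2\sigma_i^2}{2\bigl(\sum_{i=1}^n\omega_iD_i\bigr)^2}\mathbb{E}\left[\sum_{i=1}^n\omega_iN_i(\tau)\right].$$
   Context: Let $n\ge 1$, let $B_1,\dots,B_n$ be independent standard Brownian motions (started at $0$), and let $N_i(t)=D_it+\sigma_iB_i(t)$ with $D_i>0$, $\sigma_i>0$ for $i=1,\dots,n$. Let $\{\mathcal{G}_t\}$ be the natural filtration, $\mathcal{G}_t$ being generated by $\{N_1(s),\dots,N_n(s):s\in[0,t]\}$, and let $\omega_i>0$ be the waiting cost per unit of type $i$ per unit time. *)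

(* Defs.v *)
From HB Require Import structures.
From mathcomp Require Import all_boot all_order all_algebra.
From mathcomp Require Import all_classical all_reals all_analysis.

Set Implicit Arguments.
Unset Strict Implicit.
Unset Printing Implicit Defensive.

Import Order.TTheory GRing.Theory Num.Theory.
Import numFieldNormedType.Exports.

Local Open Scope classical_set_scope.
Local Open Scope ring_scope.

(* Written in MathComp-Analysis.  Processes in continuous time are indexed by
   the whole type R, but only their values at times t >= 0 are ever
   constrained or used. *)

(* sigma(X_i : i in J) *)
Definition sigma_generated (d : measure_display) (T : measurableType d)
    (R : realType) (I : Type) (J : set I) (X : I -> T -> R) : set (set T) :=
  <<s \bigcup_(i in J) preimage_set_system setT (X i) measurable >>.

Definition mutually_independent (d : measure_display) (T : measurableType d)
    (R : realType) (P : probability T R) (I : finType)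
    (F : I -> set (set T)) : Prop :=
  forall (J : {set I}) (A : I -> set T), (forall i, i \in J -> F i (A i)) ->
    P (\bigcap_(i in [set` J]) A i) = (\prod_(i in J) P (A i))%E.

(* The law of an increment is compared with the Gaussian law on measurable sets
   only, since P is unconstrained off the sigma-algebra; the second parameter of
   normal_prob is the standard deviation. *)
Record standard_brownian_motion (d : measure_display) (T : measurableType d)
    (R : realType) (P : probability T R) (B : R -> {RV P >-> R}) : Prop := {
  bm_start : {ae P, forall w, B 0 w = 0} ;
  bm_independent_increments : forall (k : nat) (t : nat -> R),
    0 <= t 0%N -> (forall j, (j < k)%N -> t j <= t j.+1) ->
    mutually_independent P (fun j : 'I_k =>
      preimage_set_system setT (fun w => B (t j.+1) w - B (t j) w) measurable) ;
  bm_gaussian_increments : forall s t : R, 0 <= s -> s < t ->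
    forall A : set R, measurable A ->
      P [set w | A (B t w - B s w)] = normal_prob 0 (Num.sqrt (t - s)) A ;
  bm_continuous_paths :
    {ae P, forall w, {within `[0, +oo[, continuous (fun t => B t w)}}
}.
Arguments standard_brownian_motion {d T R} P B.

Definition independent_processes (d : measure_display) (T : measurableType d)
    (R : realType) (P : probability T R) (I : finType)
    (X : I -> R -> T -> R) : Prop :=
  mutually_independent P (fun i => sigma_generated `[0, +oo[ (X i)).

Definition natural_filtration (d : measure_display) (T : measurableType d)
    (R : realType) (n : nat) (X : 'I_n -> R -> T -> R) (t : R) : set (set T) :=
  sigma_generated [set p : 'I_n * R | 0 <= p.2 <= t] (fun p => X p.1 p.2).

Definition stopping_time (d : measure_display) (T : measurableType d)
    (R : realType) (G : R -> set (set T)) (tau : T -> \bar R) : Prop :=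
  (forall w, 0 <= tau w)%E /\
  (forall t : R, 0 <= t -> G t [set w | (tau w <= t%:E)%E]).

(* The underlying sigma-algebra is not assumed complete and Brownian paths are
   only almost surely continuous, so quantities built from paths are random
   variables only up to a null set: integrability is taken with respect to the
   completion of P. *)
Definition ae_integrable (d : measure_display) (T : measurableType d)
    (R : realType) (P : probability T R) (f : T -> R) : Prop :=
  exists2 g : T -> R,
    P.-integrable setT (EFin \o g) & {ae P, forall w, f w = g w}.

(* Main.v *)
(* Put W(t) = sum_i omega_i N_i(t) = mu t + M(t), where M is a martingale whose
   increments over an interval of length h are independent of the past with
   mean 0 and variance s2 h, s2 = sum_i omega_i^2 sigma_i^2.  Along a grid of
   mesh h the process

     sum_j h (W_j + W_{j+1}) / 2 - W_k^2 / (2 mu) + s2 W_k / (2 mu^2)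

   is an exact discrete-time martingale: the trapezoidal rule cancels the
   discretisation error.  Stopping it at the first grid point after tau (and at
   a deterministic time) gives the identity on the grid 2^-p Z without error
   term, and p tends to infinity by dominated convergence.  The dominating
   function is obtained from a pathwise version of Doob's L2 inequality applied
   up to tau + 1, followed by Fatou's lemma over the grids. *)

Require Import Defs.
From HB Require Import structures.
From mathcomp Require Import all_boot all_order all_algebra.
From mathcomp Require Import all_classical all_reals all_analysis.
From mathcomp Require Import measurable_realfun ring lra.

Set Implicit Arguments.
Unset Strict Implicit.
Unset Printing Implicit Defensive.

Import Order.TTheory GRing.Theory Num.Theory.
Import numFieldNormedType.Exports.

Local Open Scope classical_set_scope.
Local Open Scope ring_scope.

(** * Integration up to null sets *)

(** Working on grids keeps the probability elementary: only the events [{k h < tau}] enter, and each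
    lies in the past of time [k h], so every stopped process is a finite sum with past-measurable
    weights. The delicate point is domination, because the workload at the first grid point after
    [tau] is not controlled by its value at [tau]. Doob's bound up to [tau + 1] is at most [4 s2
    (E[tau] + 2)] on every grid, so the limit inferior of the squared maxima has finite mean; the
    dyadic grids are nested, so a value at a point of one grid is seen by all finer ones, and this
    single limit inferior bounds them all. The second moment of [tau] also takes care of the drift
    part [(mu t)^2]. A second obstacle is measurability: the cost and the stopped workload agree
    with random variables only almost surely. Their expectations still make sense, since the
    integrals of positive and negative parts are suprema over simple functions and do not see null
    sets. *)

Definition L1 d (T : measurableType d) (R : realType)
    (P : probability T R) (X : T -> R) : Prop := P.-integrable setT (EFin \o X).

Definition Ex d (T : measurableType d) (R : realType)
    (P : probability T R) (X : T -> R) : R := Rintegral P setT X.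

Section ae_nonmeasurable.
Context d (T : measurableType d) (R : realType) (P : probability T R).

Import HBNNSimple.

(* No measurability is assumed: the integral of a nonnegative function is a
   supremum over the simple functions below it, which ignores null sets. *)
Lemma ae_le_integral_ge0 (f g : T -> \bar R) :
  (forall w, 0 <= f w)%E -> (forall w, 0 <= g w)%E ->
  {ae P, forall w, f w = g w} -> (\int[P]_w f w <= \int[P]_w g w)%E.
Proof.
move=> f0 g0 [M [mM PM fgM]].
rewrite (ge0_integralTE _ f0) (ge0_integralTE _ g0).
apply: ge_ereal_sup => _ [h /= hf <-].
(* [h] is set to 0 on the null set [M]: its integral is unchanged and it now lies below [g]
   everywhere. *)
pose h' := proj_nnsfun h (measurableC mM).
apply: le_ereal_sup_tmp; exists (sintegral P h'); last first.
  rewrite -(_ : (\int[P]_w (h w)%:E)%E = sintegral P h); last first.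
    by rewrite integral_nnsfun// patch_setT.
  rewrite -(_ : (\int[P]_w (h' w)%:E)%E = sintegral P h'); last first.
    by rewrite integral_nnsfun// patch_setT.
  rewrite le_eqVlt; apply/orP; left; apply/eqP.
  apply: ae_eq_integral => //; [exact/measurable_EFinP..|].
  exists M; split => // w /= hw; apply: contrapT => Mw; apply: hw => _.
  by rewrite /= mindicE mem_set// mulr1.
exists h' => //= w; rewrite /= mindicE.
have [Mw|Mw] := boolP (w \in ~` M); last by rewrite mulr0.
rewrite mulr1 (le_trans (hf w))// le_eqVlt; apply/orP; left; apply/eqP.
by apply: contrapT => fg; move: Mw; rewrite inE; apply; apply: fgM.
Qed.

Lemma ae_eq_expectation (X Y : T -> R) :
  {ae P, forall w, X w = Y w} -> ('E_P[X] = 'E_P[Y])%E.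
Proof.
move=> XY; rewrite unlock integralE [RHS]integralE.
have XY' (f : R -> \bar R) : (forall x, 0 <= f x)%E ->
    (\int[P]_w f (X w) = \int[P]_w f (Y w))%E.
  move=> f0; apply/eqP; rewrite eq_le !ae_le_integral_ge0//;
  by apply: filterS XY => w ->.
rewrite ![in LHS]unlock ![in RHS]unlock.
by rewrite (XY' (fun x => maxe x%:E 0%E)) ?(XY' (fun x => maxe (- x%:E)%E 0%E))//
  => x; rewrite le_max lexx orbT.
Qed.

Lemma ExE (X : T -> R) : L1 P X -> 'E_P[X]%E = (Ex P X)%:E.
Proof. by move=> X1; rewrite unlock fineK//; exact: integrable_fin_num. Qed.

(** [f] may fail to be measurable. The upper limit of the [f_ n] is a measurable version of it;
    dominated convergence is applied to that version and the result is carried back to [f] by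
    [ae_eq_expectation]. *)
Lemma ae_dominated (f_ : nat -> T -> R) (f g : T -> R) :
    (forall n, measurable_fun setT (f_ n)) -> L1 P g ->
    {ae P, forall w n, `|f_ n w| <= g w} ->
    {ae P, forall w, f_ ^~ w @ \oo --> f w} ->
  [/\ ae_integrable P f, 'E_P[f]%E \is a fin_num &
      Ex P (f_ n) @[n --> \oo] --> fine 'E_P[f]%E].
Proof.
move=> mf_ g1 fg ff.
pose f' w := fine (limn_esup (fun n => (f_ n w)%:E)).
have ff' : {ae P, forall w, f w = f' w}.
  apply: filterS ff => w fw; rewrite /f'.
  have fwE : (f_ n w)%:E @[n --> \oo] --> (f w)%:E.
    by apply: cvg_EFin => //; exact: nearW.
  by rewrite is_cvg_limn_esupE ?(cvg_lim _ fwE)//; apply/cvg_ex; exists (f w)%:E.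
have mf' : measurable_fun setT f'.
  apply: (measurableT_comp (fine_measurable _)) => //.
  by apply: measurable_fun_limn_esup => n; exact/measurable_EFinP.
have [f'1 _ cvg_f'] : [/\ P.-integrable setT (EFin \o f'),
     [sequence \int[P]_x `|(f_ n x)%:E - (f' x)%:E|]_n%E @ \oo --> 0%E &
     [sequence \int[P]_x (f_ n x)%:E]_n%E @ \oo --> (\int[P]_x (f' x)%:E)%E].
  apply: (@dominated_convergence _ _ _ _ _ _ (fun n => EFin \o f_ n) _
    (EFin \o g)) => //.
  - by move=> n; exact/measurable_EFinP.
  - exact/measurable_EFinP.
  - apply: filterS2 ff ff' => w fw fw' _; rewrite /= -fw'.
    by apply: cvg_EFin => //; exact: nearW.
  - by apply: filterS fg => w fw n _ /=; rewrite lee_fin.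
have Ef : 'E_P[f]%E = (Ex P f')%:E by rewrite (ae_eq_expectation ff') ExE.
split; first by exists f'.
  by rewrite Ef.
rewrite Ef /Ex/=.
have : fine (\int[P]_x (f_ n x)%:E)%E @[n --> \oo] --> fine (\int[P]_x (f' x)%:E)%E.
  by apply: fine_cvg; rewrite fineK// integrable_fin_num.
by [].
Qed.

End ae_nonmeasurable.

Section L1_theory.
Context d (T : measurableType d) (R : realType) (P : probability T R).
Implicit Types X Y : T -> R.

Lemma L1_measurable X : L1 P X -> measurable_fun setT X.
Proof. by move=> /measurable_int/measurable_EFinP. Qed.

Lemma L1_le X Y : measurable_fun setT X -> L1 P Y ->
  (forall w, `|X w| <= `|Y w|) -> L1 P X.
Proof.
move=> mX Y1 XY; apply: le_integrable Y1 => //; first exact/measurable_EFinP.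
by move=> w _ /=; rewrite lee_fin.
Qed.

Lemma L1_cst (c : R) : L1 P (fun=> c).
Proof. exact: finite_measure_integrable_cst. Qed.

Lemma L1_add X Y : L1 P X -> L1 P Y -> L1 P (fun w => X w + Y w).
Proof. by move=> X1 Y1; have := integrableD measurableT X1 Y1. Qed.

Lemma L1_scale c X : L1 P X -> L1 P (fun w => c * X w).
Proof. by move=> X1; have := integrableZl measurableT c X1. Qed.

Lemma L1_opp X : L1 P X -> L1 P (fun w => - X w).
Proof.
by move=> X1; have := L1_scale (-1) X1; under eq_fun do rewrite mulN1r.
Qed.

Lemma L1_sub X Y : L1 P X -> L1 P Y -> L1 P (fun w => X w - Y w).
Proof. by move=> X1 Y1; exact/L1_add/L1_opp. Qed.

Lemma L1_sum I (s : seq I) (p : pred I) (X : I -> T -> R) :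
  (forall i, p i -> L1 P (X i)) -> L1 P (fun w => \sum_(i <- s | p i) X i w).
Proof.
move=> X1; elim: s => [|i s IH].
  by under eq_fun do rewrite big_nil; exact: L1_cst.
have [pi|npi] := boolP (p i).
  by under eq_fun do rewrite big_cons pi; exact/L1_add/IH/X1.
by under eq_fun do rewrite big_cons (negbTE npi).
Qed.

Lemma L1_norm X : L1 P X -> L1 P (fun w => `|X w|).
Proof.
move=> X1; apply: (L1_le _ X1) => [|w]; last by rewrite normr_id.
by apply: measurableT_comp => //; exact: L1_measurable.
Qed.

Lemma L1_indic A X : measurable A -> L1 P X -> L1 P (fun w => \1_A w * X w).
Proof.
move=> mA X1; apply: (L1_le _ X1) => [|w].
  by apply: measurable_funM; [exact: measurable_indic|exact: L1_measurable].
rewrite normrM indicE; case: (_ \in _); rewrite ?normr1 ?mul1r//.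
by rewrite normr0 mul0r.
Qed.

Lemma L1_mul X Y : measurable_fun setT X -> measurable_fun setT Y ->
  L1 P (fun w => X w ^+ 2) -> L1 P (fun w => Y w ^+ 2) ->
  L1 P (fun w => X w * Y w).
Proof.
move=> mX mY X2 Y2; apply: (L1_le _ (L1_add X2 Y2)) => [|w].
  exact: measurable_funM.
rewrite normrM [leRHS]ger0_norm ?addr_ge0 ?sqr_ge0//.
rewrite -(real_normK (num_real (X w))) -(real_normK (num_real (Y w))).
have := normr_ge0 (X w); have := normr_ge0 (Y w); nra.
Qed.

Lemma L1_sqr X : measurable_fun setT X -> L1 P (fun w => X w ^+ 2) -> L1 P X.
Proof.
move=> mX X2; apply: (L1_le mX (L1_add (L1_cst 1) X2)) => w.
rewrite [leRHS]ger0_norm ?addr_ge0 ?sqr_ge0//.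
rewrite -(real_normK (num_real (X w))).
have := normr_ge0 (X w); nra.
Qed.

Lemma Ex_cst c : Ex P (fun=> c) = c.
Proof. by rewrite /Ex Rintegral_cst//= probability_setT mulr1. Qed.

Lemma Ex_add X Y : L1 P X -> L1 P Y ->
  Ex P (fun w => X w + Y w) = Ex P X + Ex P Y.
Proof. exact: RintegralD. Qed.

Lemma Ex_sub X Y : L1 P X -> L1 P Y ->
  Ex P (fun w => X w - Y w) = Ex P X - Ex P Y.
Proof. exact: RintegralB. Qed.

Lemma Ex_scale c X : L1 P X -> Ex P (fun w => c * X w) = c * Ex P X.
Proof. exact: RintegralZl. Qed.

Lemma Ex_sum I (s : seq I) (X : I -> T -> R) :
  (forall i, L1 P (X i)) ->
  Ex P (fun w => \sum_(i <- s) X i w) = \sum_(i <- s) Ex P (X i).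
Proof.
move=> X1; elim: s => [|i s IH].
  rewrite big_nil -[RHS](Ex_cst 0); congr Ex; apply/funext => w.
  by rewrite big_nil.
rewrite big_cons -IH -Ex_add//; last exact: L1_sum.
by congr Ex; apply/funext => w; rewrite big_cons.
Qed.

Lemma Ex_le X Y : L1 P X -> L1 P Y -> (forall w, X w <= Y w) ->
  Ex P X <= Ex P Y.
Proof. by move=> X1 Y1 XY; exact: le_Rintegral. Qed.

Lemma Ex_ae X Y : {ae P, forall w, X w = Y w} -> Ex P X = Ex P Y.
Proof.
by move=> XY; have := ae_eq_expectation XY; rewrite unlock /Ex /Rintegral => ->.
Qed.

Lemma L1_ae X Y : measurable_fun setT X -> {ae P, forall w, X w = Y w} ->
  L1 P Y -> L1 P X.
Proof.
move=> mX XY Y1; apply/integrableP; split; first exact/measurable_EFinP.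
have /integrableP[mY] := Y1; apply: le_lt_trans; rewrite le_eqVlt.
apply/orP; left; apply/eqP; apply: ae_eq_integral => //.
- by apply: measurableT_comp => //; exact/measurable_EFinP.
- exact: measurableT_comp.
- by apply: filterS XY => w /= ->.
Qed.

End L1_theory.

(** * Independence and Gaussian moments *)

Section independence.
Context d (T : measurableType d) (R : realType) (P : probability T R).
Variable G : set (set T).
Hypothesis Gmeas : <<s G >> `<=` @measurable d T.
Let GT : measurableType _ := g_sigma_algebraType G.

Variable Y : {RV P >-> R}.
Hypothesis GY : forall A U, <<s G >> A -> measurable U ->
  P (A `&` Y @^-1` U) = (P A * P (Y @^-1` U))%E.

(* By uniqueness of product measures, the joint law of [w] (observed through
   [G]) and [Y] is a product, and Fubini's theorem applies. *)
Lemma Ex_indep (C : T -> R) (g : R -> R) :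
  measurable_fun (setT : set GT) (C : GT -> R) -> measurable_fun setT g ->
  L1 P C -> L1 P (fun w => g (Y w)) ->
  L1 P (fun w => C w * g (Y w)) /\
  Ex P (fun w => C w * g (Y w)) = Ex P C * Ex P (fun w => g (Y w)).
Proof.
move=> mC mg C1 gY1.
have mid : measurable_fun setT (fun w : T => w : GT).
  by move=> _ A mA; rewrite setTI; apply: Gmeas.
pose I : {mfun T >-> GT} := HB.pack_for {mfun T >-> GT} (fun w : T => w : GT)
  (isMeasurableFun.Build _ _ T GT _ mid).
have mphi : measurable_fun setT (fun w : T => (w : GT, Y w)).
  exact: measurable_fun_pair.
pose phi : {mfun T >-> (GT * R)%type} :=
  HB.pack_for {mfun T >-> (GT * R)%type} (fun w : T => (w : GT, Y w))
  (isMeasurableFun.Build _ _ T (GT * R)%type _ mphi).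
pose m1 := distribution P I.
pose m2 := distribution P Y.
pose m := distribution P phi.
have mE X : measurable X -> (m1 \x m2)%E X = m X.
  apply: product_measure_unique => A B mA mB.
  rewrite /m /m1 /m2 /distribution /pushforward /=.
  exact: GY.
pose f (z : GT * R) := (C z.1 * g z.2)%:E.
have mf : measurable_fun setT f.
  apply/measurable_EFinP; apply: measurable_funM.
    exact: measurableT_comp mC measurable_fst.
  exact: measurableT_comp mg measurable_snd.
have C1' : m1.-integrable setT (EFin \o C).
  by apply: (@integrable_pushforward _ _ _ _ _ I) => //; exact/measurable_EFinP.
have g1' : m2.-integrable setT (EFin \o g).
  apply: (@integrable_pushforward _ _ _ _ _ Y) => //; exact/measurable_EFinP.
have [mCE C1fin] := integrableP _ _ _ C1'.
have [mgE g1fin] := integrableP _ _ _ g1'.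
have intf : (m1 \x m2)%E.-integrable setT f.
  apply/integrable12ltyP => //.
  under eq_integral => x _.
    under eq_integral do rewrite /f /= normrM EFinM.
    rewrite ge0_integralZl//; last by apply/measurable_EFinP; exact: measurableT_comp.
    over.
  rewrite ge0_integralZr//; last exact: integral_ge0; last first.
    by apply/measurable_EFinP; exact: measurableT_comp.
  apply: lte_mul_pinfty => //; first exact: integral_ge0.
  by rewrite ge0_fin_numE//; exact: integral_ge0.
have fubini := integral12_prod_meas1 intf.
have mmE : (\int[m]_z f z = \int[m1 \x m2]_z f z)%E.
  by apply: eq_measure_integral => A mA _; exact/esym/mE.
have intm : m.-integrable setT f.
  apply/integrableP; split => //.
  have /integrableP[_] := intf; apply: le_lt_trans; rewrite le_eqVlt.
  by apply/orP; left; apply/eqP/eq_measure_integral => A mA _; exact/esym/mE.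
have fT : P.-integrable setT (f \o phi).
  apply/integrableP; split; first exact: measurableT_comp mf mphi.
  have /integrableP[_] := intm.
  by rewrite /m ge0_integral_distribution//; exact: measurableT_comp.
split => //.
have E1 : (\int[P]_w (f \o phi) w = \int[m1]_x \int[m2]_y f (x, y))%E.
  by rewrite -integral_distribution// -/m mmE fubini.
pose K := fine (\int[m2]_y (g y)%:E)%E.
have KE : (\int[m2]_y (g y)%:E = K%:E)%E by rewrite fineK// integrable_fin_num.
have E2 : (\int[m1]_x \int[m2]_y f (x, y) = \int[m1]_x ((C x)%:E * K%:E))%E.
  by apply: eq_integral => x _; rewrite -KE -integralZl.
rewrite /Ex /Rintegral E1 E2 integralZr//= fineM//; last exact: integrable_fin_num.
rewrite -KE; congr (fine _ * fine _).
  by rewrite (@integral_distribution _ _ _ _ _ _ I (EFin \o C)).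
by rewrite (@integral_distribution _ _ _ _ _ _ Y (EFin \o g)).
Qed.
End independence.

(** * Integration against a density *)

Section density.
Context d (T : measurableType d) (R : realType).
Variables (mu m : {measure set T -> \bar R}) (p : T -> R).
Hypothesis p0 : forall x, 0 <= p x.
Hypothesis mp : measurable_fun setT p.
Hypothesis mE : forall A, measurable A -> m A = (\int[mu]_(x in A) (p x)%:E)%E.

Import HBNNSimple.

Let ge0_integral_density_nnsfun (f : {nnsfun T >-> R}) :
  (\int[m]_x (f x)%:E = \int[mu]_x ((f x)%:E * (p x)%:E))%E.
Proof.
under [LHS]eq_integral do rewrite fimfunE -fsumEFin//.
rewrite [LHS]ge0_integral_fsum//; last 2 first.
  - by move=> r; exact/measurable_EFinP/measurableT_comp.
  - by move=> n x _; rewrite EFinM nnfun_muleindic_ge0.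
under [RHS]eq_integral.
  move=> x xD; rewrite muleC fimfunE -fsumEFin// ge0_mule_fsumr; last first.
    by move=> r; rewrite EFinM nnfun_muleindic_ge0.
  over.
rewrite [RHS]ge0_integral_fsum//; last 2 first.
  - move=> r; apply: emeasurable_funM; first exact/measurable_EFinP.
    by apply/measurable_EFinP; exact/measurableT_comp.
  - by move=> n x _; rewrite mule_ge0 ?lee_fin// -lee_fin EFinM nnfun_muleindic_ge0.
apply: eq_fsbigr => r _.
rewrite integralZl_indic_nnsfun// integral_indic// setIT mE//.
have [r0|r0] := ltP r 0.
  by rewrite preimage_nnfun0// integral_set0 mule0 integral0_eq// => x _;
    rewrite indicE in_set0 mulr0 mule0.
rewrite -ge0_integralZl//; last 2 first.
- by apply/measurable_EFinP/measurable_funTS.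
- by move=> x _; rewrite lee_fin.
rewrite integral_mkcond; apply: eq_integral => x _.
rewrite patchE indicE; case: ifPn => _; first by rewrite mulr1 muleC.
by rewrite mulr0 mule0.
Qed.

(** The formula passes from simple functions to [f] by monotone convergence on both sides. *)
Lemma ge0_integral_density (f : T -> \bar R) :
  measurable_fun setT f -> (forall x, 0 <= f x)%E ->
  (\int[m]_x f x = \int[mu]_x (f x * (p x)%:E))%E.
Proof.
move=> mf f0.
pose f_ := nnsfun_approx measurableT mf.
transitivity (lim (\int[m]_x (f_ n x)%:E @[n --> \oo])%E).
  rewrite -monotone_convergence//=.
  - apply: eq_integral => ? /[!inE] xD; apply/esym/cvg_lim => //=.
    exact: cvg_nnsfun_approx.
  - by move=> n; exact/measurable_EFinP/measurable_funTS.
  - by move=> n ? _; rewrite lee_fin.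
  - by move=> ? _ ? ? mn; rewrite lee_fin; exact/lefP/nd_nnsfun_approx.
transitivity (lim (\int[mu]_x ((f_ n x)%:E * (p x)%:E) @[n --> \oo])%E); last first.
  rewrite -monotone_convergence//=.
  - apply: eq_integral => x /[!inE] xD; apply/cvg_lim => //.
    apply: cvgeZr => //.
    exact: cvg_nnsfun_approx.
  - move=> n; apply: emeasurable_funM; last exact/measurable_EFinP.
    exact/measurable_EFinP/measurable_funTS.
  - by move=> n ? _; rewrite mule_ge0 ?lee_fin.
  - move=> x _ i j ij; rewrite lee_wpmul2r ?lee_fin//.
    exact/lefP/nd_nnsfun_approx.
by apply: congr_lim; apply/funext => n /=; exact: ge0_integral_density_nnsfun.
Qed.

End density.

(** * First two moments of the centred Gaussian law *)

Section gaussian_moments.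
Context (R : realType) (s : R).
Hypothesis s0 : 0 < s.
Notation mu := (@lebesgue_measure R).
Let phi := normal_pdf 0 s.
Let sN0 : s != 0. Proof. by rewrite gt_eqF. Qed.

Let phi_ge0 x : 0 <= phi x. Proof. exact: normal_pdf_ge0. Qed.

Let cphi : continuous phi. Proof. exact: continuous_normal_pdf. Qed.

Let mphi : measurable_fun setT phi. Proof. exact: measurable_normal_pdf. Qed.

Let phiE x : phi x = normal_peak s * expR (- x ^+ 2 / (s ^+ 2 *+ 2)).
Proof. by rewrite /phi normal_pdfE// /normal_fun subr0. Qed.

Let is_derive_xphi (x : R) : is_derive x (1 : R)
  (fun y : R => s ^+ 2 * (y * phi y)) ((s ^+ 2 - x ^+ 2) * phi x).
Proof.
rewrite (_ : (fun y => _) = (fun y => s ^+ 2 *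
    (y * (normal_peak s * expR (- y ^+ 2 / (s ^+ 2 *+ 2)))))); last first.
  by apply/funext => y; rewrite phiE.
rewrite phiE.
apply: is_derive_eq.
rewrite /GRing.scale /=.
by field.
Qed.

Let cF : continuous (fun x : R => s ^+ 2 * (x * phi x)).
Proof.
move=> x; apply: cvgM; first exact: cvg_cst.
by apply: cvgM; [exact: cvg_id|exact: cphi].
Qed.

(** With [u = x^2 / (2 s^2)], the inequality [1 + u <= expR u] bounds [expR (- u)] by [u^-1], hence
    the whole expression by a constant over [x]. *)
Let cvg_xphi : s ^+ 2 * (x * phi x) @[x --> +oo] --> (0 : R).
Proof.
have c0 : 0 < normal_peak s by rewrite normal_peak_gt0.
apply/cvgr0Pnorm_lt => e e0; near=> x.
have x0 : 0 < x by near: x; exact: nbhs_pinfty_gt.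
have xe : 2 * s ^+ 4 * normal_peak s / e < x.
  by near: x; apply: nbhs_pinfty_gt; exact: num_real.
rewrite ger0_norm ?mulr_ge0 ?sqr_ge0 ?(ltW x0) ?(ltW s0)//.
rewrite phiE mulNr expRN; set u := x ^+ 2 / _.
have u0 : 0 < u by rewrite divr_gt0 ?exprn_gt0// pmulrn_lgt0 ?exprn_gt0.
apply: (@le_lt_trans _ _ (s ^+ 2 * (x * (normal_peak s * u^-1)))).
  rewrite !ler_pM2l ?exprn_gt0// lef_pV2 ?posrE ?expR_gt0//.
  by rewrite (le_trans _ (expR_ge1Dx u))// lerDr.
have -> : s ^+ 2 * (x * (normal_peak s * u^-1)) = 2 * s ^+ 4 * normal_peak s / x.
  by rewrite /u; field; rewrite sN0 gt_eqF.
by rewrite ltr_pdivrMr// (mulrC e) -ltr_pdivrMr.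
Unshelve. all: by end_near. Qed.

Let cx2phi : continuous (fun x : R => x ^+ 2 * phi x).
Proof.
move=> x; apply: cvgM; last exact: cphi.
exact: exprn_continuous.
Qed.

Let cf : continuous (fun x : R => (s ^+ 2 - x ^+ 2) * phi x).
Proof.
move=> x; apply: cvgM; last exact: cphi.
by apply: cvgB; [exact: cvg_cst|exact: exprn_continuous].
Qed.

Let ge0D (A : set R) (a b : R -> R) : measurable A -> continuous a -> continuous b ->
  (forall x, A x -> 0 <= a x) -> (forall x, A x -> 0 <= b x) ->
  (\int[mu]_(x in A) (a x + b x)%:E =
   \int[mu]_(x in A) (a x)%:E + \int[mu]_(x in A) (b x)%:E)%E.
Proof.
move=> mA ca cb a0 b0; under eq_integral do rewrite EFinD.
apply: ge0_integralD => //.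
- by apply/measurable_EFinP/measurable_funTS; exact: continuous_measurable_fun.
- by apply/measurable_EFinP/measurable_funTS; exact: continuous_measurable_fun.
Qed.

Let Zphi (A : set R) : measurable A ->
  ((s ^+ 2)%:E * \int[mu]_(x in A) (phi x)%:E =
   \int[mu]_(x in A) (s ^+ 2 * phi x)%:E)%E.
Proof.
move=> mA; under [RHS]eq_integral do rewrite EFinM.
rewrite ge0_integralZl//.
- exact/measurable_EFinP/measurable_funTS.
- by move=> x _; rewrite lee_fin.
- by rewrite lee_fin sqr_ge0.
Qed.

(* [s^2 x phi] is an antiderivative of [(s^2 - x^2) phi], which changes sign
   at [s]: the two halves are integrated separately. *)
Let moment_0s :
  (\int[mu]_(x in `[0%R, s]) (x ^+ 2 * phi x)%:E + (s ^+ 2 * (s * phi s))%:E =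
  (s ^+ 2)%:E * \int[mu]_(x in `[0%R, s]) (phi x)%:E)%E.
Proof.
have FTC := @continuous_FTC2 R (fun x => (s ^+ 2 - x ^+ 2) * phi x)
  (fun x => s ^+ 2 * (x * phi x)) 0 s s0.
rewrite mul0r mulr0 sube0 in FTC.
rewrite -FTC; last 3 first.
- exact: continuous_subspaceT.
- split.
  + by move=> x _; have [] := is_derive_xphi x.
  + by apply: cvg_at_right_filter; exact: cF.
  + by apply: cvg_at_left_filter; exact: cF.
- by move=> x _; rewrite derive1E; have [_ ->] := is_derive_xphi x.
rewrite -ge0D//.
- rewrite Zphi//.
  by apply: eq_integral => x _; congr _%:E; ring.
- by move=> x _; rewrite mulr_ge0 ?sqr_ge0.
- move=> x /=; rewrite in_itv/= => /andP[x0 xs].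
  by rewrite mulr_ge0// subr_ge0 lerXn2r ?nnegrE// (le_trans x0).
Qed.

(** On this half-line [(s^2 - x^2) phi] is nonpositive, so it is negated to fit the fundamental
    theorem for nonnegative integrands on an unbounded interval; [cvg_xphi] removes the boundary
    term at infinity. *)
Let moment_sy : (\int[mu]_(x in `[s, +oo[) (x ^+ 2 * phi x)%:E =
  (s ^+ 2)%:E * \int[mu]_(x in `[s, +oo[) (phi x)%:E + (s ^+ 2 * (s * phi s))%:E)%E.
Proof.
have FTC := @ge0_continuous_FTC2y R (fun x => - ((s ^+ 2 - x ^+ 2) * phi x))
  (fun x => - (s ^+ 2 * (x * phi x))) s 0.
rewrite sub0e -EFinN opprK in FTC.
have f0 x : s <= x -> 0 <= - ((s ^+ 2 - x ^+ 2) * phi x).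
  move=> sx; rewrite -mulNr opprB mulr_ge0// subr_ge0 lerXn2r ?nnegrE//; first exact: ltW.
  by rewrite (le_trans (ltW s0)).
rewrite -FTC//; last 5 first.
- apply: continuous_subspaceT => x; apply: cvgN; exact: cf.
- by rewrite -oppr0; apply: cvgN; exact: cvg_xphi.
- by move=> x _; apply: derivableN; have [] := is_derive_xphi x.
- by apply: cvg_at_right_filter; apply: cvgN; exact: cF.
- move=> x _; rewrite derive1E deriveN; last by have [] := is_derive_xphi x.
  by have [_ ->] := is_derive_xphi x.
rewrite Zphi//.
rewrite -ge0D//.
- by apply: eq_integral => x _; congr _%:E; ring.
- by move=> x; apply: cvgM; [exact: cvg_cst|exact: cphi].
- by move=> x; apply: cvgN; exact: cf.
- by move=> x _; rewrite mulr_ge0// sqr_ge0.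
- by move=> x /=; rewrite in_itv/= andbT; exact: f0.
Qed.

Let split_0y (f : R -> R) : continuous f -> (forall x, 0 <= f x) ->
  (\int[mu]_(x in `[0%R, +oo[) (f x)%:E =
   \int[mu]_(x in `[0%R, s]) (f x)%:E + \int[mu]_(x in `[s, +oo[) (f x)%:E)%E.
Proof.
move=> cf' f0; have mf := continuous_measurable_fun cf'.
rewrite -[X in (_ + X)%E](@integral_itv_obnd_cbnd R); last first.
  exact/measurable_EFinP/measurable_funTS.
rewrite -ge0_integral_setU//=.
- by rewrite -itv_bndbnd_setU// bnd_simp// ltW.
- exact/measurable_EFinP/measurable_funTS.
- by move=> x _; rewrite lee_fin.
- apply/disj_setPS => x [] /=; rewrite !in_itv/= andbT => /andP[_ xs] sx.
  by move: xs; rewrite leNgt sx.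
Qed.

Let even_integral (f : R -> R) : continuous f -> (forall x, 0 <= f x) ->
  (forall x, f (- x) = f x) ->
  (\int[mu]_x (f x)%:E =
   2%:E * (\int[mu]_(x in `[0%R, s]) (f x)%:E + \int[mu]_(x in `[s, +oo[) (f x)%:E))%E.
Proof.
move=> cf' f0 ef; rewrite ge0_symfun_integralT//; last by move=> x /=; rewrite ef.
by rewrite -split_0y// set_itvcy.
Qed.

Let phiN x : phi (- x) = phi x.
Proof. by rewrite !phiE sqrrN. Qed.

Lemma integral_sqr_normal_prob :
  (\int[normal_prob 0 s]_x (x ^+ 2)%:E = (s ^+ 2)%:E)%E.
Proof.
rewrite (@ge0_integral_density _ _ _ mu _ phi)//; last 2 first.
- by apply/measurable_EFinP; exact: measurable_funX.
- by move=> x; rewrite lee_fin sqr_ge0.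
rewrite even_integral//; last 2 first.
- by move=> x; rewrite mulr_ge0// sqr_ge0.
- by move=> x; rewrite sqrrN phiN.
have phi1 : (\int[mu]_x (phi x)%:E = 1)%E by exact: integral_normal_pdf.
rewrite even_integral// in phi1.
(* The boundary term at [s] produced by the outer half is exactly the one that the inner half needs,
   so nothing has to be subtracted in the extended reals. *)
rewrite moment_sy addeCA moment_0s.
rewrite -ge0_muleDr ?integral_ge0//; [|by move=> x _; rewrite lee_fin..].
by rewrite addeC muleCA phi1 mule1.
Qed.

Lemma normal_probN (A : set R) : measurable A ->
  normal_prob 0 s (-%R @^-1` A) = normal_prob 0 s A.
Proof.
move=> mA; rewrite /normal_prob.
transitivity (\int[pushforward mu (-%R : R -> measurableTypeR R)]_(x in A) (phi x)%:E)%E.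
  rewrite ge0_integral_pushforward//.
  - by apply: eq_integral => x _ /=; rewrite phiN.
  - exact/measurable_EFinP/measurable_funTS.
  - by move=> x _; rewrite lee_fin.
by apply: eq_measure_integral => B mB _; exact: lebesgue_measureN.
Qed.

Lemma L1_sqr_normal_prob : L1 (normal_prob 0 s) (fun x => x ^+ 2).
Proof.
apply/integrableP; split; first by apply/measurable_EFinP; exact: measurable_funX.
under eq_integral do rewrite gee0_abs ?lee_fin ?sqr_ge0//.
by rewrite integral_sqr_normal_prob ltry.
Qed.

(** The law is invariant under negation, so the mean equals its own opposite. *)
Lemma Ex_normal_prob : Ex (normal_prob 0 s) id = 0.
Proof.
have id1 : L1 (normal_prob 0 s) id by apply: L1_sqr => //; exact: L1_sqr_normal_prob.
have : Ex (normal_prob 0 s) id = Ex (normal_prob 0 s) (fun x => -1 * x).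
  rewrite /Ex /Rintegral; congr fine.
  transitivity (\int[pushforward (normal_prob 0 s) (-%R : R -> measurableTypeR R)]_x x%:E)%E.
    by apply: eq_measure_integral => B mB _; rewrite /= /pushforward normal_probN.
  rewrite integral_pushforward//.
  - by apply: eq_integral => x _ /=; rewrite mulN1r.
  exact: (L1_opp id1).
rewrite Ex_scale//; lra.
Qed.

End gaussian_moments.

(** * Independence of Brownian increments from the past *)

Section pi_lambda.
Context d (T : measurableType d) (R : realType) (P : probability T R).

(** The measurable sets independent of [E] form a Dynkin system, and this one contains the pi-system
    [Pi]. *)
Lemma indep_pi_lambda (Pi : set (set T)) (E : set T) :
  setI_closed Pi -> Pi `<=` @measurable d T -> measurable E ->
  (forall A, Pi A -> P (A `&` E) = (P A * P E)%E) ->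
  forall A, <<s Pi >> A -> P (A `&` E) = (P A * P E)%E.
Proof.
move=> PiI Pim mE PiE.
have sPim : <<s Pi >> `<=` @measurable d T.
  apply: smallest_sub => //; exact: sigma_algebra_measurable.
apply: (@dynkin_induction _ (g_sigma_algebraType Pi)) => //.
- by rewrite setTI probability_setT mul1e.
- move=> S /sPim mS PSE.
  rewrite probability_setC// muleBl ?mul1e//; last first.
    exact: fin_num_measure.
  rewrite -PSE setIC -setDE measureD//.
    by rewrite setIC.
  by rewrite ltey_eq fin_num_measure.
- move=> F /= mF tF PF; have {}mF k := sPim _ (mF k).
  rewrite setI_bigcupl measure_bigcup//=; last 2 first.
  + by move=> k _; exact: measurableI.
  + exact: trivIset_setIr.
  rewrite measure_bigcup//.
  have PEE : P E = (fine (P E))%:E by rewrite fineK// fin_num_measure.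
  rewrite PEE muleC -nneseriesZl//.
  by apply: eq_eseriesr => k _; rewrite PF -PEE muleC.
Qed.

(** Meant for [B 0], which vanishes only almost surely: events on values of [B] and events on its
    increments from time 0 agree only off a null set. *)
Lemma measure_eq_off (X Y N : set T) : measurable X -> measurable Y ->
  measurable N -> P N = 0%E -> (forall w, ~ N w -> X w <-> Y w) -> P X = P Y.
Proof.
move=> mX mY mN PN XY.
have le (X' Y' : set T) : measurable X' -> measurable Y' ->
    (forall w, ~ N w -> X' w -> Y' w) -> (P X' <= P Y')%E.
  move=> mX' mY' XY'; apply: (@le_trans _ _ (P (Y' `|` N))).
    apply: le_measure; rewrite ?inE//; first exact: measurableU.
    by move=> w X'w; have [Nw|Nw] := pselect (N w); [right|left; exact: XY'].
  by rewrite -[leRHS]adde0 -PN; exact: measureU2.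
by apply/eqP; rewrite eq_le !le// => w Nw; have [] := XY w Nw.
Qed.

End pi_lambda.

(** * Cylinder sets as a generating pi-system *)

Section cylinders.
Context d (T : measurableType d) (R : realType) (I : Type).
Variables (J : set I) (X : I -> T -> R).

(** Finite intersections of preimages, built one factor at a time so that their properties follow by
    induction. *)
Inductive cylinder : set T -> Prop :=
| cylinderT : cylinder setT
| cylinderI r U A : J r -> measurable U -> cylinder A ->
    cylinder (X r @^-1` U `&` A).

Lemma cylinder_setI_closed : setI_closed cylinder.
Proof.
move=> A B; elim=> [|r U A' Jr mU cA IH] cB; first by rewrite setTI.
by rewrite -setIA; apply: cylinderI => //; exact: IH.
Qed.

Lemma sigma_generated_le (G : set (set T)) : sigma_algebra setT G ->
  (forall r U, J r -> measurable U -> G (X r @^-1` U)) ->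
  sigma_generated J X `<=` G.
Proof.
move=> sG JG; apply: smallest_sub => // _ [r Jr [U mU <-]].
by rewrite setTI; exact: JG.
Qed.

Lemma sigma_generated_preimage r U : J r -> measurable U ->
  sigma_generated J X (X r @^-1` U).
Proof.
move=> Jr mU; apply: sub_sigma_algebra; exists r => //; exists U => //.
by rewrite setTI.
Qed.

Lemma sigma_generated_sigma_algebra : sigma_algebra setT (sigma_generated J X).
Proof. exact: smallest_sigma_algebra. Qed.

Lemma sigma_generatedI A B : sigma_generated J X A -> sigma_generated J X B ->
  sigma_generated J X (A `&` B).
Proof.
move=> sA sB.
exact: (@measurableI _ (g_sigma_algebraType
  (\bigcup_(r in J) preimage_set_system setT (X r) measurable))).
Qed.

Lemma sigma_generatedT : sigma_generated J X setT.
Proof.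
exact: (@measurableT _ (g_sigma_algebraType
  (\bigcup_(r in J) preimage_set_system setT (X r) measurable))).
Qed.

Lemma cylinder_sigma_generated : cylinder `<=` sigma_generated J X.
Proof.
move=> A; elim=> [|r U {}A Jr mU _ IH]; first exact: sigma_generatedT.
by apply: sigma_generatedI => //; exact: sigma_generated_preimage.
Qed.

Lemma sigma_generated_cylinder : sigma_generated J X `<=` <<s cylinder >>.
Proof.
apply: sigma_generated_le; first exact: smallest_sigma_algebra.
move=> r U Jr mU; apply: sub_sigma_algebra.
by rewrite -[_ @^-1` _]setIT; apply: cylinderI => //; exact: cylinderT.
Qed.

Lemma sigma_generated_measurable :
  (forall r, J r -> measurable_fun setT (X r)) ->
  sigma_generated J X `<=` @measurable d T.
Proof.
move=> mX; apply: sigma_generated_le; first exact: sigma_algebra_measurable.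
by move=> r U Jr mU; rewrite -[_ @^-1` _]setTI; exact: mX.
Qed.

End cylinders.

Lemma sigma_generated_sub d (T : measurableType d) (R : realType) (I I' : Type)
    (J : set I) (J' : set I') (X : I -> T -> R) (X' : I' -> T -> R) :
  (forall r, J r -> exists2 r', J' r' & X r = X' r') ->
  sigma_generated J X `<=` sigma_generated J' X'.
Proof.
move=> JJ'; apply: sigma_generated_le; first exact: sigma_generated_sigma_algebra.
by move=> r U /JJ'[r' J'r' ->] mU; exact: sigma_generated_preimage.
Qed.

(** A name for the generators, so that [g_sigma_algebraType] can be formed on them;
    [<<s gens J X >>] is [sigma_generated J X] by conversion. *)
Definition gens d (T : measurableType d) (R : realType) (I : Type) (J : set I)
    (X : I -> T -> R) : set (set T) :=
  \bigcup_(i in J) preimage_set_system setT (X i) measurable.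

Lemma gens_measurable_fun d (T : measurableType d) (R : realType) (I : Type)
    (J : set I) (X : I -> T -> R) r : J r ->
  measurable_fun (setT : set (g_sigma_algebraType (gens J X))) (X r).
Proof. by move=> Jr _ U mU; rewrite setTI; exact: sigma_generated_preimage. Qed.

Definition bm_incr d (T : measurableType d) (R : realType)
    (P : probability T R) (B : R -> {RV P >-> R}) (t u : R) : T -> R :=
  fun w => B u w - B t w.

Section brownian_past.
Context d (T : measurableType d) (R : realType) (P : probability T R).
Variable B : R -> {RV P >-> R}.
Hypothesis hB : standard_brownian_motion P B.

Let incr (tt : nat -> R) (j : nat) : T -> R := bm_incr B (tt j) (tt j.+1).

Let mincr tt j : measurable_fun setT (incr tt j).
Proof. exact: measurable_funB. Qed.

Let msub (X : T -> R) U : measurable_fun setT X -> measurable U ->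
  d.-measurable (X @^-1` U).
Proof. by move=> mX mU; rewrite -[_ @^-1` _]setTI; exact: mX. Qed.

(** Independence of increments speaks of one event per index, so factors with the same index are
    merged by intersecting their sets. *)
Lemma cylinder_rect (tt : nat -> R) (k : nat) (A : set T) :
  cylinder [set j | (j < k)%N] (incr tt) A ->
  exists2 U : nat -> set R, (forall j, measurable (U j)) &
    A = \bigcap_(j in [set j | (j < k)%N]) incr tt j @^-1` U j.
Proof.
elim=> [|r U {}A rk mU _ [V mV ->]].
  by exists (fun=> setT) => //; apply/esym/seteqP; split.
exists (fun j => if j == r then V j `&` U else V j).
  by move=> j; case: ifP => // _; exact: measurableI.
apply/seteqP; split => [w [Uw Vw] j jk /=|w Vw].
  by case: eqP => [->|_]; [split => //|]; exact: Vw.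
split; first by have := Vw r rk; rewrite /= eqxx => -[].
by move=> j jk; have := Vw j jk; rewrite /=; case: ifP => // _ [].
Qed.

Lemma bm_grid_indep (tt : nat -> R) (k : nat) :
  0 <= tt 0%N -> (forall j, (j < k.+1)%N -> tt j <= tt j.+1) ->
  forall A U, sigma_generated [set j | (j < k)%N] (incr tt) A -> measurable U ->
  P (A `&` incr tt k @^-1` U) = (P A * P (incr tt k @^-1` U))%E.
Proof.
move=> t0 tt_le A U sA mU.
apply: (@indep_pi_lambda _ _ _ _ (cylinder [set j | (j < k)%N] (incr tt))).
- exact: cylinder_setI_closed.
- move=> C cC; apply: (@sigma_generated_measurable _ _ _ _ [set j | (j < k)%N] (incr tt)).
    by move=> r _; exact: mincr.
  exact: cylinder_sigma_generated.
- exact: msub.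
- move=> _ /cylinder_rect[V mV ->].
  have ind := bm_independent_increments hB t0 tt_le.
  have prodE (W : nat -> set R) : (forall j, measurable (W j)) ->
      P (\bigcap_(j in [set j | (j < k)%N]) incr tt j @^-1` W j `&` incr tt k @^-1` W k) =
      (\prod_(j < k) P (incr tt j @^-1` W j) * P (incr tt k @^-1` W k))%E.
    move=> mW; have := ind [set: 'I_k.+1]%SET (fun j => incr tt j @^-1` W j).
    rewrite (_ : \bigcap_(i in [set` [set: 'I_k.+1]%SET]) _ =
       \bigcap_(j in [set j | (j < k)%N]) incr tt j @^-1` W j `&` incr tt k @^-1` W k).
      move=> ->; last by move=> i _; exists (W i) => //; rewrite setTI.
      rewrite big_mkcond /= big_ord_recr /= finset.in_setT.
      by congr (_ * _)%E; apply: eq_bigr => i _; rewrite finset.in_setT.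
    apply/seteqP; split => [w Ww|w [Ww Wk] i _].
      split; last by have := Ww ord_max; apply; rewrite /= finset.in_setT.
      move=> j jk; have := Ww (widen_ord (leqnSn k) (Ordinal jk)); apply.
      by rewrite /= finset.in_setT.
    have [ik|ik] := ltnP i k; first exact: Ww.
    by have -> : nat_of_ord i = k by apply/eqP; rewrite eqn_leq ik andbT -ltnS.
  (* The product formula is used twice: with [U] at the last index for the intersection, and with
     [setT] there to evaluate the probability of the rectangle alone. *)
  have /= E1 := prodE (fun j => if j == k then U else V j).
  have /= E2 := prodE (fun j => if j == k then setT else V j).
  have eqV (X : set R) : \bigcap_(j in [set j | (j < k)%N])
      incr tt j @^-1` (if j == k then X else V j) =
      \bigcap_(j in [set j | (j < k)%N]) incr tt j @^-1` V j.
    by apply: eq_bigcapr => j /= jk; rewrite ltn_eqF.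
  have eqP (X : set R) : (\prod_(j < k) P (incr tt j @^-1` (if j == k :> nat then X else V j)) =
      \prod_(j < k) P (incr tt j @^-1` V j))%E.
    by apply: eq_bigr => j _; rewrite ltn_eqF.
  rewrite eqxx eqV eqP in E1.
  rewrite eqxx eqV eqP preimage_setT setIT probability_setT mule1 in E2.
  by rewrite E1 ?E2// => j; case: ifP.
- exact: sigma_generated_cylinder.
Qed.

(* The times are only finitely many, so they can be sorted into a grid. *)
Lemma bm_finite_past (t u : R) (l : seq R) : 0 <= t -> t < u ->
  (forall r, r \in l -> 0 <= r <= t) ->
  forall A U, sigma_generated [set r : R | r \in l] (fun r => bm_incr B 0 r) A ->
  measurable U ->
  P (A `&` bm_incr B t u @^-1` U) =
  (P A * P (bm_incr B t u @^-1` U))%E.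
Proof.
move=> t0 tu lt A U sA mU.
pose s := 0 :: rcons (sort <=%R l) t.
(* The default value [u] of [nth] is the grid point that follows [t], so increment number [k] is the
   one from [t] to [u]. *)
pose tt := nth u s.
have sl : sorted <=%R s.
    rewrite (sorted_pairwise le_trans) /s pairwise_cons all_rcons t0 /=.
  rewrite pairwise_rcons -(sorted_pairwise le_trans) (sort_sorted le_total) andbT.
  by apply/andP; split; apply/allP => r; rewrite mem_sort => /lt/andP[].
pose k := (size l).+1.
have ss : size s = k.+1 by rewrite /= size_rcons size_sort.
have ttk : tt k = t by rewrite /tt /s /= nth_rcons size_sort ltnn eqxx.
have ttk1 : tt k.+1 = u by rewrite /tt nth_default// ss.
have tt_le j : (j < k.+1)%N -> tt j <= tt j.+1.
  move=> jk; have [jk'|jk'] := ltnP j k.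
    by apply: (sorted_leq_nth le_trans lexx) => //; rewrite inE ss.
  have -> : j = k by apply/eqP; rewrite eqn_leq jk' -ltnS jk.
  by rewrite ttk ttk1 ltW.
have := @bm_grid_indep tt k (lexx _) tt_le A U _ mU.
rewrite /incr ttk ttk1; apply.
apply: sigma_generated_le A sA; first exact: sigma_generated_sigma_algebra.
move=> r V rl mV.
have rs : r \in s by rewrite inE mem_rcons inE mem_sort rl !orbT.
have [m mk <-] : exists2 m, (m <= k)%N & tt m = r.
  by exists (index r s); [rewrite -ltnS -ss index_mem|exact: nth_index].
have -> : bm_incr B 0 (tt m) = fun w => \sum_(j < m) incr tt j w.
  apply/funext => w; rewrite -(big_mkord xpredT (fun j => incr tt j w)).
  by rewrite (telescope_sumr (fun j => B (tt j) w)).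
rewrite -[X in sigma_generated _ _ X]setTI.
pose GT := g_sigma_algebraType (gens [set j | (j < k)%N] (incr tt)).
suff : measurable_fun (setT : set GT) (fun w => \sum_(j < m) incr tt j w).
  by apply.
apply: measurable_sum => j; apply: gens_measurable_fun => /=.
exact: leq_trans (ltn_ord j) mk.
Qed.

(** A cylinder involves finitely many times. Each [B r] in it is replaced by [B r - B 0], a sum of
    increments over a grid; both agree where [B 0] vanishes. *)
Lemma cylinder_finite_past (t : R) (A : set T) :
  cylinder [set r | 0 <= r <= t] (fun r => B r) A ->
  exists (l : seq R) A', [/\ (forall r, r \in l -> 0 <= r <= t),
    sigma_generated [set r : R | r \in l] (fun r => bm_incr B 0 r) A' &
    forall w, B 0 w = 0 -> A w <-> A' w].
Proof.
elim=> [|r U {}A rt mU _ [l [A' [lt sA' AA']]]].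
  exists [::], setT; split => //; exact: sigma_generatedT.
exists (r :: l), (bm_incr B 0 r @^-1` U `&` A'); split.
- by move=> r'; rewrite inE => /predU1P[->//|]; exact: lt.
- apply: sigma_generatedI.
    apply: (@sigma_generated_preimage _ _ _ _ _ (fun r => bm_incr B 0 r)) => //=.
    by rewrite mem_head.
  apply: sigma_generated_sub sA' => r' /= r'l; exists r' => //=.
  by rewrite inE r'l orbT.
- by move=> w B0; split => -[]; rewrite /= /bm_incr B0 subr0 => Uw /AA' -/(_ B0).
Qed.

Lemma bm_past_indep (t u : R) : 0 <= t -> t < u ->
  forall A U, cylinder [set r | 0 <= r <= t] (fun r => B r) A ->
  measurable U ->
  P (A `&` bm_incr B t u @^-1` U) =
  (P A * P (bm_incr B t u @^-1` U))%E.
Proof.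
move=> t0 tu A U cA mU.
have [l [A' [lt sA' AA']]] := cylinder_finite_past cA.
have [N [mN PN B0N]] := bm_start hB.
have mA : measurable A.
  apply: sigma_generated_measurable (cylinder_sigma_generated cA).
  by move=> r _; exact: measurable_funP.
have mA' : measurable A'.
  apply: sigma_generated_measurable sA' => r _; exact: measurable_funB.
have mUu : measurable (bm_incr B t u @^-1` U).
  by apply: msub => //; exact: measurable_funB.
have NB w : ~ N w -> B 0 w = 0.
  by move=> Nw; apply: contrapT => B0; apply: Nw; exact: B0N.
rewrite (@measure_eq_off _ _ _ P A A' N)//; last by move=> w /NB/AA'.
rewrite -(bm_finite_past t0 tu lt sA' mU).
apply: (@measure_eq_off _ _ _ _ _ _ N) => //; [exact: measurableI..|].
by move=> w /NB/AA'[? ?]; split=> -[]; split; auto.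
Qed.

End brownian_past.

(* Including the other motions at all times lets a single independence statement
   also cover the product of the increments of two different motions. *)
Definition other_or_past (R : realType) (n : nat) (i : 'I_n) (t : R) :
    set ('I_n * R) :=
  [set p | 0 <= p.2 /\ (p.1 = i -> p.2 <= t)].

Section independent_brownian.
Context d (T : measurableType d) (R : realType) (P : probability T R) (n : nat).
Variable B : 'I_n -> R -> {RV P >-> R}.
Hypothesis hB : forall i, standard_brownian_motion P (B i).
Hypothesis hindep : independent_processes P (fun i t => B i t : T -> R).

Let X (p : 'I_n * R) : T -> R := B p.1 p.2.

(** Groups the factors by motion, to match the independence of the processes. The factor of motion
    [i] only involves times up to [t] and stays a cylinder, as [bm_past_indep] requires. *)
Lemma cylinder_split i t (A : set T) : cylinder (other_or_past i t) X A ->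
  exists F : 'I_n -> set T,
    [/\ cylinder [set r : R | 0 <= r <= t] (B i) (F i),
        forall j, sigma_generated `[0, +oo[ (fun r => B j r : T -> R) (F j) &
        A = \bigcap_(j in [set` [set: 'I_n]%SET]) F j].
Proof.
elim=> [|[j r] U {}A /= [r0 rt] mU _ [F [Fi Fj ->]]].
  exists (fun=> setT); split; [exact: cylinderT|move=> j; exact: sigma_generatedT|].
  by apply/esym/seteqP; split.
exists (fun k => if k == j then B j r @^-1` U `&` F k else F k); split.
- have [ij|] := eqVneq i j; last by [].
  by rewrite -ij; apply: cylinderI => //=; rewrite r0 rt.
- move=> k; case: eqP => [->|_]; last exact: Fj.
  apply: sigma_generatedI; last exact: Fj.
  apply: (@sigma_generated_preimage _ _ _ _ _ (fun r => B j r : T -> R)) => //=.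
  by rewrite in_itv/= r0.
- apply/seteqP; split => [w [Uw Fw] k _|w Fw].
    by case: eqP => [->|_]; [split => //|]; apply: Fw; rewrite /= finset.in_setT.
  split; first by have := Fw j; rewrite /= finset.in_setT eqxx => /(_ isT)[].
  move=> k _; have := Fw k; rewrite /= finset.in_setT => /(_ isT).
  by case: ifP => // _ [].
Qed.

Lemma bm_indep i (t u : R) : 0 <= t -> t < u ->
  forall A U, sigma_generated (other_or_past i t) X A -> measurable U ->
  P (A `&` bm_incr (B i) t u @^-1` U) =
  (P A * P (bm_incr (B i) t u @^-1` U))%E.
Proof.
move=> t0 tu A U sA mU.
have msig : sigma_generated (other_or_past i t) X `<=` @measurable d T.
  by apply: sigma_generated_measurable => r _; exact: measurable_funP.
have mE : measurable (bm_incr (B i) t u @^-1` U).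
  by rewrite -[_ @^-1` _]setTI; apply: measurable_funB.
apply: (@indep_pi_lambda _ _ _ _ (cylinder (other_or_past i t) X)) => //.
- exact: cylinder_setI_closed.
- by move=> C /cylinder_sigma_generated/msig.
- move=> _ /cylinder_split[F [Fi Fj ->]].
  (* The increment is absorbed into the factor of motion [i]. Independence of the processes then
     applies with and without it, and the two products differ in that factor only. *)
  pose F' j := if j == i then F i `&` bm_incr (B i) t u @^-1` U else F j.
  have -> : \bigcap_(j in [set` [set: 'I_n]%SET]) F j `&` bm_incr (B i) t u @^-1` U =
      \bigcap_(j in [set` [set: 'I_n]%SET]) F' j.
    rewrite /F'; apply/seteqP; split => [w [Fw Uw] k _|w Fw].
      case: eqP => [_|_]; last by apply: Fw; rewrite /= finset.in_setT.
      by split => //; apply: Fw; rewrite /= finset.in_setT.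
    split; last by have := Fw i; rewrite /= finset.in_setT eqxx => /(_ isT)[].
    move=> k _; have := Fw k; rewrite /= finset.in_setT => /(_ isT).
    by case: eqP => // -> [].
  rewrite (hindep _ (A := F)); last by move=> j _; exact: Fj.
  rewrite (hindep _ (A := F')); last first.
    move=> j _; rewrite /F'; case: eqP => [->|_]; last exact: Fj.
    apply: sigma_generatedI; first exact: Fj.
    rewrite -[X in sigma_generated _ _ X]setTI.
    apply: (measurable_funB (D := setT : set (g_sigma_algebraType
      (gens `[0, +oo[ (fun r => B i r : T -> R))))) => //;
    apply: gens_measurable_fun; rewrite /= in_itv/= andbT//.
    by rewrite (le_trans t0)// ltW.
  have iT : i \in [set: 'I_n]%SET by rewrite finset.in_setT.
  rewrite (bigD1 i iT) [in RHS](bigD1 i iT)/=.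
  rewrite [F' i]/F' eqxx (bm_past_indep (hB i))//.
  rewrite -!muleA; congr (_ * _)%E; rewrite muleC; congr (_ * _)%E.
  by apply: eq_bigr => j /andP[_ ji]; rewrite /F' (negbTE ji).
- exact: sigma_generated_cylinder.
Qed.

End independent_brownian.

(** * The driving martingale *)

(** Measurability is a clause of its own, because integrability of the square does not give it. *)
Definition L2 d (T : measurableType d) (R : realType)
    (P : probability T R) (X : T -> R) : Prop :=
  measurable_fun setT X /\ L1 P (fun w => X w ^+ 2).

Section L2_theory.
Context d (T : measurableType d) (R : realType) (P : probability T R).
Implicit Types X Y : T -> R.

Lemma L2_L1 X : L2 P X -> L1 P X.
Proof. by case=> mX; exact: L1_sqr. Qed.

Lemma L2_mul X Y : L2 P X -> L2 P Y -> L1 P (fun w => X w * Y w).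
Proof. by case=> mX X2 [mY Y2]; exact: L1_mul. Qed.

Lemma L2_le X Y : measurable_fun setT X -> L2 P Y ->
  (forall w, `|X w| <= `|Y w|) -> L2 P X.
Proof.
move=> mX [mY Y2] XY; split => //; apply: (L1_le _ Y2) => [|w].
  exact: measurable_funX.
by rewrite !normrX lerXn2r ?nnegrE.
Qed.

Lemma L2_cst c : L2 P (fun=> c).
Proof. by split => //; exact: L1_cst. Qed.

Lemma L2_add X Y : L2 P X -> L2 P Y -> L2 P (fun w => X w + Y w).
Proof.
move=> X2 Y2; split; first by apply: measurable_funD; [exact: X2.1|exact: Y2.1].
under eq_fun do rewrite sqrrD.
apply: L1_add; last exact: Y2.2; apply: L1_add; first exact: X2.2.
under eq_fun do rewrite -mulr_natl.
by apply: L1_scale; exact: L2_mul.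
Qed.

Lemma L2_scale c X : L2 P X -> L2 P (fun w => c * X w).
Proof.
move=> [mX X2]; split; first exact: measurable_funM.
by under eq_fun do rewrite exprMn; exact: L1_scale.
Qed.

Lemma L2_sub X Y : L2 P X -> L2 P Y -> L2 P (fun w => X w - Y w).
Proof.
move=> X2 /(L2_scale (-1)) Y2; have := L2_add X2 Y2.
by under eq_fun do rewrite mulN1r.
Qed.

Lemma L2_sum I (s : seq I) (X : I -> T -> R) :
  (forall i, L2 P (X i)) -> L2 P (fun w => \sum_(i <- s) X i w).
Proof.
move=> X2; elim: s => [|i s IH].
  by under eq_fun do rewrite big_nil; exact: L2_cst.
by under eq_fun do rewrite big_cons; exact: L2_add.
Qed.

Lemma L2_norm X : L2 P X -> L2 P (fun w => `|X w|).
Proof.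
move=> X2; apply: (L2_le _ X2) => [|w]; last by rewrite normr_id.
by apply: measurableT_comp => //; exact: X2.1.
Qed.

Lemma L2_indic A X : measurable A -> L2 P X -> L2 P (fun w => \1_A w * X w).
Proof.
move=> mA X2; apply: (L2_le _ X2) => [|w].
  by apply: measurable_funM => //; exact: X2.1.
rewrite normrM indicE; case: (_ \in _); rewrite ?normr1 ?mul1r//.
by rewrite normr0 mul0r.
Qed.

Lemma L2_ae X Y : measurable_fun setT X -> {ae P, forall w, X w = Y w} ->
  L2 P Y -> L2 P X.
Proof.
move=> mX XY [mY Y2]; split => //; apply: L1_ae Y2; first exact: measurable_funX.
by apply: filterS XY => w ->.
Qed.

End L2_theory.

Lemma sub_sigma_fun d (T : measurableType d) d' (S : measurableType d')
    (G G' : set (set T)) (C : T -> S) : <<s G >> `<=` <<s G' >> ->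
  measurable_fun (setT : set (g_sigma_algebraType G)) C ->
  measurable_fun (setT : set (g_sigma_algebraType G')) C.
Proof. by move=> GG' mC _ U mU; apply: GG'; exact: mC. Qed.

Section bm_moments.
Context d (T : measurableType d) (R : realType) (P : probability T R).
Variable B : R -> {RV P >-> R}.
Hypothesis hB : standard_brownian_motion P B.

Lemma measurable_bm_incr t u : measurable_fun setT (bm_incr B t u).
Proof. exact: measurable_funB. Qed.

Definition bm_incr_rv t u : {RV P >-> R} := HB.pack_for {mfun T >-> R}
  (bm_incr B t u) (isMeasurableFun.Build _ _ T R _ (measurable_bm_incr t u)).

Variables t u : R.
Hypotheses (t0 : 0 <= t) (tu : t < u).
Let s := Num.sqrt (u - t).
Let s0 : 0 < s. Proof. by rewrite sqrtr_gt0 subr_gt0. Qed.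

Let mincr : measurable_fun setT (bm_incr B t u : T -> measurableTypeR R).
Proof. exact: measurable_bm_incr. Qed.

Let Delta : {mfun T >-> measurableTypeR R} :=
  HB.pack_for {mfun T >-> measurableTypeR R}
  (bm_incr B t u : T -> measurableTypeR R)
  (isMeasurableFun.Build _ _ T (measurableTypeR R) _ mincr).

Let lawI (f : R -> \bar R) : (\int[normal_prob 0 s]_x f x =
  \int[distribution P Delta]_x f x)%E.
Proof.
apply: eq_measure_integral => A mA _; apply/esym.
exact: (bm_gaussian_increments hB t0 tu).
Qed.

Lemma bm_incr_L2 : L2 P (bm_incr B t u).
Proof.
split; first exact: measurable_bm_incr.
apply/integrableP; split.
  by apply/measurable_EFinP/measurable_funX; exact: measurable_bm_incr.
have /integrableP[_] := L1_sqr_normal_prob s0.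
rewrite lawI.
rewrite ge0_integral_distribution//.
by apply: measurableT_comp => //; apply/measurable_EFinP; exact: measurable_funX.
Qed.

Lemma Ex_bm_incr : Ex P (bm_incr B t u) = 0.
Proof.
rewrite -(Ex_normal_prob s0) /Ex /Rintegral; congr fine.
rewrite lawI.
rewrite integral_distribution//.
exact/L2_L1/bm_incr_L2.
Qed.

Lemma Ex_bm_incr_sqr : Ex P (fun w => bm_incr B t u w ^+ 2) = u - t.
Proof.
have h0 : 0 <= u - t by rewrite subr_ge0 ltW.
rewrite -[RHS](sqr_sqrtr h0) -/s -[RHS]/(fine (s ^+ 2)%:E).
rewrite -integral_sqr_normal_prob//  /Ex /Rintegral; congr fine.
rewrite lawI.
rewrite integral_distribution//; last exact: bm_incr_L2.2.
by apply/measurable_EFinP; exact: measurable_funX.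
Qed.

End bm_moments.

Lemma bm_L2 d (T : measurableType d) (R : realType) (P : probability T R)
    (B : R -> {RV P >-> R}) (t : R) :
  standard_brownian_motion P B -> 0 <= t -> L2 P (B t).
Proof.
move=> hB; rewrite le_eqVlt => /predU1P[<-|t0].
  apply: (@L2_ae _ _ _ _ _ (fun=> 0)) => //; last exact: L2_cst.
  exact: bm_start hB.
apply: (@L2_ae _ _ _ _ _ (bm_incr B 0 t)) => //; last exact: bm_incr_L2.
by apply: filterS (bm_start hB) => w; rewrite /bm_incr => ->; rewrite subr0.
Qed.

Section martingale.
Context d (T : measurableType d) (R : realType) (P : probability T R) (n : nat).
Variable B : 'I_n -> R -> {RV P >-> R}.
Hypothesis hB : forall i, standard_brownian_motion P (B i).
Hypothesis hindep : independent_processes P (fun i t => B i t : T -> R).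
Variable c : 'I_n -> R.

Definition past (t : R) : set ('I_n * R) := [set p | 0 <= p.2 <= t].

Definition Bpair (p : 'I_n * R) : T -> R := B p.1 p.2.

Definition past_gens (t : R) : set (set T) := gens (past t) Bpair.

(** The martingale part of the workload once [c i] is [omega i * sigma i]; [comb_variance] is then
    its variance per unit of time. *)
Definition bm_comb (t : R) : T -> R := fun w => \sum_(i < n) c i * B i t w.

Definition bm_comb_incr (t u : R) : T -> R := fun w => bm_comb u w - bm_comb t w.

Definition comb_variance : R := \sum_(i < n) c i ^+ 2.

Lemma past_gens_measurable t : <<s past_gens t >> `<=` @measurable d T.
Proof. by apply: sigma_generated_measurable => r _; exact: measurable_funP. Qed.

Lemma past_gens_le t u : t <= u -> <<s past_gens t >> `<=` <<s past_gens u >>.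
Proof.
move=> tu; apply: sigma_generated_sub => p /= /andP[p0 pt]; exists p => //=.
by apply/andP; split => //; exact: le_trans tu.
Qed.

Lemma measurable_bm_comb t u : 0 <= t -> t <= u ->
  measurable_fun (setT : set (g_sigma_algebraType (past_gens u))) (bm_comb t).
Proof.
move=> t0 tu; apply: measurable_sum => i; apply: measurable_funM => //.
by apply: (@gens_measurable_fun _ _ _ _ (past u) Bpair (i, t)); apply/andP.
Qed.

Lemma bm_comb_L2 t : 0 <= t -> L2 P (bm_comb t).
Proof. by move=> t0; apply: L2_sum => i; apply/L2_scale/bm_L2. Qed.

Lemma bm_comb_incrE t u w :
  bm_comb_incr t u w = \sum_(i < n) c i * bm_incr (B i) t u w.
Proof.
by rewrite /bm_comb_incr /bm_comb -sumrB; apply: eq_bigr => i _; rewrite -mulrBr.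
Qed.

Lemma bm_comb_incr_L2 t u : 0 <= t -> t < u -> L2 P (bm_comb_incr t u).
Proof.
by move=> t0 tu; apply: L2_sub; apply: bm_comb_L2 => //; rewrite (le_trans t0)// ltW.
Qed.

Let Gto i t : <<s past_gens t >> `<=` <<s gens (other_or_past i t) Bpair >>.
Proof.
apply: sigma_generated_sub => p /= /andP[p0 pt]; by exists p.
Qed.

Lemma Ex_mul_incr i t u (C : T -> R) : 0 <= t -> t < u ->
  measurable_fun (setT : set (g_sigma_algebraType (gens (other_or_past i t) Bpair))) C ->
  L1 P C -> L1 P (fun w => C w * bm_incr (B i) t u w) /\
  Ex P (fun w => C w * bm_incr (B i) t u w) = 0.
Proof.
move=> t0 tu mC C1.
have Gm : <<s gens (other_or_past i t) Bpair >> `<=` @measurable d T.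
  by apply: sigma_generated_measurable => r _; exact: measurable_funP.
have [] := @Ex_indep _ _ _ P _ Gm (bm_incr_rv (B i) t u) _ C id mC _ C1.
- by move=> A U sA mU; exact: (bm_indep hB hindep).
- exact: measurable_id.
- exact/L2_L1/bm_incr_L2.
- by move=> L1C ->; split => //; rewrite [X in _ * X](Ex_bm_incr (hB i))// mulr0.
Qed.

Lemma Ex_mul_bm_comb_incr t u (C : T -> R) : 0 <= t -> t < u ->
  measurable_fun (setT : set (g_sigma_algebraType (past_gens t))) C ->
  L1 P C -> L1 P (fun w => C w * bm_comb_incr t u w) /\
  Ex P (fun w => C w * bm_comb_incr t u w) = 0.
Proof.
move=> t0 tu mC C1.
have Ci i := Ex_mul_incr t0 tu (sub_sigma_fun (Gto (i := i) (t := t)) mC) C1.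
have CE : (fun w => C w * bm_comb_incr t u w) =
    fun w => \sum_(i < n) c i * (C w * bm_incr (B i) t u w).
  apply/funext => w; rewrite bm_comb_incrE mulr_sumr; apply: eq_bigr => i _.
  by rewrite mulrCA.
rewrite CE; split; first by apply: L1_sum => i _; apply: L1_scale; exact: (Ci i).1.
rewrite Ex_sum; last by move=> i; apply: L1_scale; exact: (Ci i).1.
by rewrite big1// => i _; rewrite Ex_scale ?(Ci i).2 ?mulr0//; exact: (Ci i).1.
Qed.

(** The square is expanded into products of two increments. For [j != i], the indicator times [D j]
    is measurable for the past of motion [i] joined with the other motions, so the term has mean 0;
    for [j = i], the event is independent of the squared increment. *)
Lemma Ex_indic_bm_comb_incr_sqr t u (A : set T) :
  0 <= t -> t < u -> <<s past_gens t >> A ->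
  Ex P (fun w => \1_A w * bm_comb_incr t u w ^+ 2) = comb_variance * (u - t) * Ex P \1_A.
Proof.
move=> t0 tu GA; have mA := past_gens_measurable GA.
pose D i := bm_incr (B i) t u.
have D2 i : L2 P (D i) by exact: bm_incr_L2.
have AD1 i j : L1 P (fun w => \1_A w * D j w * D i w).
  by apply: L2_mul => //; exact: L2_indic.
have mAG i : measurable_fun (setT : set (g_sigma_algebraType
    (gens (other_or_past i t) Bpair))) (\1_A : T -> R).
  apply: (sub_sigma_fun (@Gto i t)).
  exact: (@measurable_indic _ (g_sigma_algebraType (past_gens t))).
have AE : (fun w => \1_A w * bm_comb_incr t u w ^+ 2) =
    fun w => \sum_(i < n) \sum_(j < n) c i * c j * (\1_A w * D j w * D i w).
  apply/funext => w; rewrite bm_comb_incrE expr2 mulr_suml mulr_sumr.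
  apply: eq_bigr => i _.
  rewrite !mulr_sumr; apply: eq_bigr => j _; rewrite -/(D i) -/(D j); ring.
rewrite AE Ex_sum; last by move=> i; apply: L1_sum => j _; exact: L1_scale.
rewrite /comb_variance !mulr_suml; apply: eq_bigr => i _.
rewrite Ex_sum; last by move=> j; exact: L1_scale.
rewrite (bigD1 i)//= big1 ?addr0; last first.
  move=> j ji; rewrite Ex_scale//.
  have [||_ ->] := @Ex_mul_incr i t u (fun w => \1_A w * D j w) t0 tu.
  - apply: measurable_funM; first exact: mAG.
    apply: measurable_funB;
      apply: (@gens_measurable_fun _ _ _ _ (other_or_past i t) Bpair (j, _)); split => //=.
    + by rewrite (le_trans t0)// ltW.
    + by move=> ij; rewrite ij eqxx in ji.
  - exact/L1_indic/L2_L1.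
  - by rewrite mulr0.
rewrite Ex_scale// expr2 -!mulrA; congr (_ * (_ * _)).
have Gm : <<s gens (other_or_past i t) Bpair >> `<=` @measurable d T.
  by apply: sigma_generated_measurable => r _; exact: measurable_funP.
have [] := @Ex_indep _ _ _ P _ Gm (bm_incr_rv (B i) t u) _ \1_A (fun x => x ^+ 2) (mAG i).
- by move=> A' U sA mU; exact: (bm_indep hB hindep).
- exact: measurable_funX.
- exact: integrable_indic.
- exact: (D2 i).2.
- move=> _; rewrite [Ex P (fun w => (bm_incr_rv _ _ _ w) ^+ 2)](Ex_bm_incr_sqr (hB i))//.
  rewrite mulrC => <-; congr Ex; apply/funext => w.
  by rewrite -mulrA -expr2.
Qed.

End martingale.

(** * Martingale identities on a grid *)

(** The value at 0 is 1, so that the absolute value is 1 everywhere. *)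
Definition sgn (R : realType) (x : R) : R := if 0 <= x then 1 else -1.

Lemma measurable_sgn (R : realType) : measurable_fun setT (@sgn R).
Proof.
by apply: measurable_fun_ifT => //; exact: measurable_fun_ler.
Qed.

Lemma sgn_mul_le (R : realType) (x y : R) : sgn x * y <= `|y|.
Proof.
by rewrite /sgn; case: ifP => _; rewrite ?mul1r ?mulN1r ?ler_norm// -normrN ler_norm.
Qed.

Lemma sgn_mul (R : realType) (x : R) : sgn x * x = `|x|.
Proof.
rewrite /sgn; case: ifPn => [x0|]; first by rewrite mul1r ger0_norm.
by rewrite -ltNge => x0; rewrite mulN1r ltr0_norm.
Qed.

Lemma sgn_norm (R : realType) (x : R) : `|sgn x| = 1.
Proof. by rewrite /sgn; case: ifP; rewrite ?normrN normr1. Qed.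

(** The maximum starts from 0 and skips [q 0], which is 0 for the processes considered. *)
Fixpoint running_max (R : realType) (q : nat -> R) (k : nat) : R :=
  if k is j.+1 then Num.max (running_max q j) `|q k| else 0.

Lemma running_max_ge0 (R : realType) (q : nat -> R) k : 0 <= running_max q k.
Proof. by elim: k => //= k IH; rewrite le_max IH. Qed.

Lemma running_max_ge (R : realType) (q : nat -> R) j k : q 0%N = 0 ->
  (j <= k)%N -> `|q j| <= running_max q k.
Proof.
move=> q0; elim: k => [|k IH]; first by rewrite leqn0 => /eqP ->; rewrite q0 normr0.
rewrite leq_eqVlt => /predU1P[->|]; first by rewrite /= le_max lexx orbT.
by move=> /IH jk; rewrite /= le_max jk.
Qed.

(* Pathwise form of Doob's L2 inequality: the sum is a martingale transform of
   [q], so it disappears on taking expectations. *)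
Lemma doob_pathwise (R : realType) (q : nat -> R) m : q 0%N = 0 ->
  running_max q m ^+ 2 <= 4 * q m ^+ 2 -
    4 * \sum_(k < m) running_max q k * sgn (q k) * (q k.+1 - q k).
Proof.
move=> q0; set a := running_max q.
have key : \sum_(k < m) a k * sgn (q k) * (q k.+1 - q k) <=
    a m * `|q m| - a m ^+ 2 / 2.
  elim: m => [|m IH]; first by rewrite big_ord0 q0 normr0 /a /= expr0n/=; lra.
  rewrite big_ord_recr/=; have := sgn_mul_le (q m) (q m.+1); have := sgn_mul (q m).
  have a0 : 0 <= a m by exact: running_max_ge0.
  rewrite -mulrA mulrBr; set x := sgn _ * _; set y := sgn _ * _ => -> yle.
  apply: (@le_trans _ _ (a m * `|q m.+1| - a m ^+ 2 / 2)).
    by have := ler_wpM2l a0 yle; rewrite mulrBr; move: IH; lra.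
  rewrite /a /= -/a; have [am|am] := leP `|q m.+1| (a m); first exact: lexx.
  nra.
rewrite -(real_normK (num_real (q m))).
(* By [key] the right-hand side is at least [4 q^2 - 4 a |q| + 2 a^2 = a^2 + (a - 2 |q|)^2]. *)
have := sqr_ge0 (a m - 2 * `|q m|); nra.
Qed.

Section grid.
Context d (T : measurableType d) (R : realType) (P : probability T R) (n : nat).
Variable B : 'I_n -> R -> {RV P >-> R}.
Hypothesis hB : forall i, standard_brownian_motion P (B i).
Hypothesis hindep : independent_processes P (fun i t => B i t : T -> R).
Variable c : 'I_n -> R.
Variables (h : R) (A : nat -> set T).
Hypothesis h0 : 0 < h.

Let tm (k : nat) : R := k%:R * h.
Hypothesis GA : forall k, <<s past_gens B (k%:R * h) >> (A k).

Let tm0 k : 0 <= tm k. Proof. by rewrite mulr_ge0// ltW. Qed.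
Let tmS k : tm k.+1 - tm k = h. Proof. by rewrite /tm -natr1; ring. Qed.
Let tm_lt k : tm k < tm k.+1. Proof. by rewrite -subr_gt0 tmS. Qed.
Let tm_le j k : (j <= k)%N -> tm j <= tm k.
Proof. by move=> jk; rewrite ler_pM2r// ler_nat. Qed.

Let mA k : measurable (A k). Proof. by apply: past_gens_measurable; exact: GA. Qed.

Let Gt_fun t (C : T -> R) :
  measurable_fun (setT : set (g_sigma_algebraType (past_gens B t))) C ->
  measurable_fun setT C.
Proof. by move=> mC _ U mU; apply: past_gens_measurable; exact: mC. Qed.

Let X k : T -> R := bm_comb_incr B c (tm k) (tm k.+1).
Let X2 k : L2 P (X k). Proof. exact: bm_comb_incr_L2. Qed.

(** A martingale transform. When [A k] is the event that a stopping time exceeds [k h], it is the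
    martingale part stopped at the first grid point not before that time, or at step [m], less its
    value at time 0. *)
Definition stopped (m : nat) : T -> R :=
  fun w => \sum_(k < m) \1_(A k) w * bm_comb_incr B c (k%:R * h) (k.+1%:R * h) w.

Let GTm k := g_sigma_algebraType (past_gens B (tm k)).

Lemma measurable_indic_past j k : (j <= k)%N ->
  measurable_fun (setT : set (GTm k)) (\1_(A j) : T -> R).
Proof.
move=> jk; apply: (sub_sigma_fun (@past_gens_le _ _ _ _ _ B _ _ (tm_le jk))).
apply: (@measurable_indic _ (g_sigma_algebraType (past_gens B (tm j)))); exact: GA.
Qed.

Let X_Gt j k : (j < k)%N -> measurable_fun (setT : set (GTm k)) (X j).
Proof.
move=> jk; apply: measurable_funB; apply: measurable_bm_comb => //;
  by apply: tm_le => //; exact: ltnW.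
Qed.

Lemma measurable_stopped m : measurable_fun (setT : set (GTm m)) (stopped m).
Proof.
apply: measurable_sum => j; apply: measurable_funM; last exact: X_Gt.
by apply: measurable_indic_past; exact: ltnW.
Qed.

Lemma stopped_L2 m : L2 P (stopped m).
Proof. by apply: L2_sum => k; apply: L2_indic => //; exact: X2. Qed.

Lemma stopped0 w : stopped 0 w = 0.
Proof. by rewrite /stopped big_ord0. Qed.

Lemma stoppedS m w : stopped m.+1 w = stopped m w + \1_(A m) w * X m w.
Proof. by rewrite /stopped big_ord_recr. Qed.

Let Ex_mul_X k (C : T -> R) : measurable_fun (setT : set (GTm k)) C -> L1 P C ->
  L1 P (fun w => C w * X k w) /\ Ex P (fun w => C w * X k w) = 0.
Proof. by move=> mC C1; apply: Ex_mul_bm_comb_incr. Qed.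

(** Orthogonality of martingale increments: the cross term is an increment times the past-measurable
    [C], so it has mean 0. *)
Lemma Ex_stopped_sqr m :
  Ex P (fun w => stopped m w ^+ 2) = comb_variance c * h * \sum_(k < m) Ex P \1_(A k).
Proof.
elim: m => [|m IH].
  rewrite big_ord0 mulr0 -[RHS](Ex_cst P 0); congr Ex; apply/funext => w.
  by rewrite /stopped big_ord0 expr0n.
pose C w := stopped m w * \1_(A m) w.
have mC : measurable_fun (setT : set (GTm m)) C.
  by apply: measurable_funM; [exact: measurable_stopped|exact: measurable_indic_past].
have C1 : L1 P C.
  rewrite /C; under eq_fun do rewrite mulrC.
  exact/L1_indic/L2_L1/stopped_L2.
have [CX1 CX] := Ex_mul_X mC C1.
have -> : (fun w => stopped m.+1 w ^+ 2) = fun w =>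
    stopped m w ^+ 2 + (2 * (C w * X m w) + \1_(A m) w * X m w ^+ 2).
  apply/funext => w; rewrite stoppedS.
  have : \1_(A m) w ^+ 2 = \1_(A m) w :> R.
    by rewrite indicE; case: (_ \in _); rewrite ?expr1n ?expr0n.
  by rewrite /C => i2; rewrite sqrrD exprMn i2; ring.
have AX1 := L1_indic (mA m) (X2 m).2.
have CX2 := L1_scale 2 CX1.
rewrite Ex_add; [|exact: (stopped_L2 m).2|exact: L1_add].
rewrite Ex_add// Ex_scale// CX mulr0 add0r IH.
rewrite (Ex_indic_bm_comb_incr_sqr hB hindep)//; last exact: GA.
by rewrite -/(tm _) tmS big_ord_recr/= mulrDr.
Qed.

Let a k w := running_max (stopped ^~ w) k.

Let a_Gt k : measurable_fun (setT : set (GTm k)) (a k).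
Proof.
elim: k => [|k IH]; first exact: measurable_cst.
apply: (@measurable_maxr _ (GTm k.+1) R setT (a k) (fun w => `|stopped k.+1 w|)).
  apply: sub_sigma_fun IH; apply: past_gens_le; exact: tm_le.
by apply: measurableT_comp => //; exact: measurable_stopped.
Qed.

Let a_L2 k : L2 P (a k).
Proof.
elim: k => [|k IH]; first exact: L2_cst.
apply: (L2_le _ (L2_add IH (L2_norm (stopped_L2 k.+1)))).
  exact: Gt_fun (a_Gt (k := k.+1)).
move=> w; rewrite [leLHS]ger0_norm ?running_max_ge0//.
rewrite [leRHS]ger0_norm ?addr_ge0 ?running_max_ge0//.
by rewrite /a /= ge_max lerDl lerDr normr_ge0 running_max_ge0.
Qed.

(** The bound is left in terms of the probabilities of the [A k]: multiplied by [h], their sum is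
    later compared with the mean of [tau], uniformly in the mesh. *)
Lemma doob m : L1 P (fun w => running_max (stopped ^~ w) m ^+ 2) /\
  Ex P (fun w => running_max (stopped ^~ w) m ^+ 2) <=
    4 * (comb_variance c * h * \sum_(k < m) Ex P \1_(A k)).
Proof.
split; first exact: (a_L2 m).2.
pose C k w := a k w * sgn (stopped k w) * \1_(A k) w.
have mC k : measurable_fun (setT : set (GTm k)) (C k).
  apply: measurable_funM; last exact: measurable_indic_past.
  apply: measurable_funM; first exact: a_Gt.
  apply: (measurableT_comp (@measurable_sgn R)); exact: measurable_stopped.
have C1 k : L1 P (C k).
  apply: (L1_le _ (L2_L1 (a_L2 k))).
    exact: Gt_fun (mC k).
  move=> w; rewrite /C !normrM sgn_norm mulr1 indicE.
  by case: (_ \in _); rewrite ?normr1 ?mulr1// normr0 mulr0.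
have CX1 k := (Ex_mul_X (mC k) (C1 k)).1.
have CX k := (Ex_mul_X (mC k) (C1 k)).2.
rewrite -Ex_stopped_sqr.
have Csum : L1 P (fun w => \sum_(k < m) C k w * X k w) by exact: L1_sum.
have S2 := (stopped_L2 m).2.
have -> : 4 * Ex P (fun w => stopped m w ^+ 2) = Ex P (fun w => 4 * stopped m w ^+ 2 -
    4 * \sum_(k < m) C k w * X k w).
  rewrite Ex_sub; [|exact: L1_scale..].
  rewrite !Ex_scale// Ex_sum// big1 ?mulr0 ?subr0//.
apply: Ex_le; first exact: (a_L2 m).2.
  by apply: L1_sub; exact: L1_scale.
move=> w; have := doob_pathwise m (q := stopped ^~ w).
rewrite stopped0 => /(_ erefl) /le_trans; apply.
rewrite lerD2l lerN2 le_eqVlt; apply/orP; left; apply/eqP; congr (_ * _).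
apply: eq_bigr => k _; by rewrite stoppedS addrAC subrr add0r /C -!mulrA.
Qed.

Variable mu : R.
Hypothesis mu0 : mu != 0.

Definition drifted (t : R) : T -> R := fun w => mu * t + bm_comb B c t w.

Let W_L2 k : L2 P (drifted (tm k)).
Proof. by apply: L2_add; [exact: L2_cst|exact: bm_comb_L2]. Qed.

Definition trapezoid m : T -> R := fun w =>
  \sum_(k < m) \1_(A k) w * (h * (drifted (k%:R * h) w + drifted (k.+1%:R * h) w) / 2).

Definition telescoped (f : R -> R) m : T -> R := fun w =>
  \sum_(k < m) \1_(A k) w * (f (drifted (k.+1%:R * h) w) - f (drifted (k%:R * h) w)).

(* The summand of the difference of both sides is a predictable multiple of the
   increment [X k] plus [(comb_variance c * h - X k ^+ 2) / (2 mu)] on the event [A k]. *)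
Lemma grid_identity m :
  [/\ L1 P (trapezoid m), L1 P (telescoped (fun x => x ^+ 2) m),
      L1 P (telescoped id m) &
      Ex P (trapezoid m) =
        1 / (2 * mu) * Ex P (telescoped (fun x => x ^+ 2) m) -
        comb_variance c / (2 * mu ^+ 2) * Ex P (telescoped id m)].
Proof.
have T1 : L1 P (trapezoid m).
  apply: L1_sum => k _; apply: L1_indic => //.
  under eq_fun do rewrite mulrAC.
  by apply: L1_scale; apply: L1_add; exact/L2_L1/W_L2.
have Q1 : L1 P (telescoped (fun x => x ^+ 2) m).
  by apply: L1_sum => k _; apply: L1_indic => //; apply: L1_sub; exact: (W_L2 _).2.
have I1 : L1 P (telescoped id m).
  by apply: L1_sum => k _; apply: L1_indic => //; apply: L1_sub; exact/L2_L1/W_L2.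
split=> //; apply/eqP; rewrite -subr_eq0; apply/eqP.
(* The coefficient of [X k] after substituting [W_{k+1} = W_k + mu h + X_k]. The terms
   [h W_k + mu h^2 / 2] occur both in the trapezoid and in the difference of squares over [2 mu],
   and cancel. *)
pose C k w := \1_(A k) w *
  (- drifted (tm k) w / mu - h / 2 + comb_variance c / (2 * mu ^+ 2)).
have mC k : measurable_fun (setT : set (GTm k)) (C k).
  apply: measurable_funM; first exact: measurable_indic_past.
  apply: measurable_funD => //; apply: measurable_funB => //.
  apply: measurable_funM => //; apply: measurableT_comp => //.
  by apply: measurable_funD => //; exact: measurable_bm_comb.
have C1 k : L1 P (C k).
  apply: L1_indic => //; apply: L1_add; last exact: L1_cst.
  apply: L1_sub; last exact: L1_cst.
  under eq_fun do rewrite mulrC.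
  by apply: L1_scale; apply: L1_opp; exact/L2_L1/W_L2.
have CX1 k := (Ex_mul_X (mC k) (C1 k)).1.
have CX k := (Ex_mul_X (mC k) (C1 k)).2.
have AX1 k := L1_indic (mA k) (X2 k).2.
have I1k k : L1 P (\1_(A k) : T -> R) by exact: integrable_indic.
rewrite -!Ex_scale// -!Ex_sub//; try by [exact: L1_scale|apply: L1_sub; exact: L1_scale].
pose D k w := C k w * X k w + (comb_variance c * h / (2 * mu) * \1_(A k) w -
  1 / (2 * mu) * (\1_(A k) w * X k w ^+ 2)).
have D1 k : L1 P (D k) by apply: L1_add => //; apply: L1_sub; exact: L1_scale.
transitivity (Ex P (fun w => \sum_(k < m) D k w)).
  congr Ex; apply/funext => w.
  rewrite /trapezoid /telescoped !mulr_sumr -!sumrB; apply: eq_bigr => k _.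
  have -> : drifted (k.+1%:R * h) w = drifted (k%:R * h) w + mu * h + X k w.
    have e : k.+1%:R * h = k%:R * h + h by rewrite -natr1 mulrDl mul1r.
    by rewrite /drifted /X /bm_comb_incr /tm [in mu * _]e; ring.
  by rewrite /D /C; field.
rewrite Ex_sum// big1// => k _.
rewrite Ex_add//; last by apply: L1_sub; exact: L1_scale.
rewrite CX Ex_sub; [|exact: L1_scale..].
rewrite !Ex_scale// (Ex_indic_bm_comb_incr_sqr hB hindep)//; last exact: GA.
by rewrite -/(tm _) tmS; field.
Qed.

End grid.

(** * Convergence of the trapezoidal rule *)

(** Compactness in its near-covering form, with the modulus [dlt] tending to 0 from the right as the
    parameter. *)
Lemma heine_cantor (R : realType) (f : R -> R) (a b e : R) :
  continuous f -> 0 < e ->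
  exists2 dlt : R, 0 < dlt & forall s t, a <= s <= b -> `|t - s| < dlt -> `|f t - f s| < e.
Proof.
move=> cf e0.
have : near_covering `[a, b]%classic.
  by apply/compact_near_coveringP; exact: segment_compact.
move=> /(_ _ (0 : R)^'+ (fun dlt s => forall t, `|t - s| < dlt -> `|f t - f s| < e)).
case.
- move=> x _; have e20 : 0 < e / 2 by rewrite divr_gt0.
  have /cvgrPdist_lt/(_ _ e20)/nbhs_ballP[eta /= eta0 fx] := cf x.
  exists (ball x (eta / 2), [set dlt | dlt < eta / 2]) => /=.
    split; first by apply: nbhsx_ballx; rewrite divr_gt0.
    by apply: nbhs_right_lt; rewrite divr_gt0.
  move=> [s dlt] [/= xs dlte] t ts.
  rewrite /ball /= in xs.
  rewrite (splitr e) -(subrKA (f x)) addrC.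
  have sx : ball x eta s by rewrite /ball /= (lt_trans xs)// ltr_pdivrMr// ltr_pMr// ltr1n.
  have tx : ball x eta t.
    rewrite /ball /= distrC -(subrKA s) (le_lt_trans (ler_normD _ _))//.
    by rewrite (splitr eta) ltrD// ?(lt_trans ts)// distrC.
  rewrite (le_lt_trans (ler_normD _ _))// ltrD//; first exact: fx.
  by rewrite distrC; exact: fx.
- move=> r /= r0 rD; exists (r / 2); first by rewrite divr_gt0.
  move=> s t sab ts; apply: (rD (r / 2)) => //=.
  + by rewrite sub0r normrN gtr0_norm ?divr_gt0// ltr_pdivrMr// ltr_pMr// ltr1n.
  + by rewrite divr_gt0.
Qed.

Lemma cvg_dist_le (R : realType) (u h : nat -> R) (x : R) :
  h p @[p --> \oo] --> (0 : R) -> (\forall p \near \oo, `|u p - x| <= h p) ->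
  u p @[p --> \oo] --> x.
Proof.
move=> hcvg ux; apply/cvgrPdist_le => e e0.
have /cvgrPdist_le/(_ _ e0) hle := hcvg.
near=> p; rewrite distrC (@le_trans _ _ (h p))//; first by near: p.
have : `|0 - h p| <= e by near: p.
by rewrite sub0r normrN; exact/le_trans/ler_norm.
Unshelve. all: by end_near. Qed.

Section trapezoid_rule.
Context (R : realType) (f : R -> R).
Hypothesis cf : continuous f.
Notation leb := (@lebesgue_measure R).

(** The primitive is based at -1, so that 0 is an interior point where [F] has a two-sided
    derivative. *)
Let F (t : R) : R := \int[leb]_(u in `[-1, t]) f u.

Let integrable_f (a b : R) : leb.-integrable `[a, b] (EFin \o f).
Proof.
apply: continuous_compact_integrable; first exact: segment_compact.
exact: continuous_subspaceT.
Qed.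

Let F_derive (t : R) : -1 < t -> derivable F t 1 /\ F^`()%classic t = f t.
Proof.
move=> t1; apply: (@continuous_FTC1_closed _ f (-1) t (t + 1)) => //; last exact: cf.
by rewrite ltrDl.
Qed.

Let F_cont (t : R) : -1 < t -> {for t, continuous F}.
Proof.
by move=> /F_derive[dF _]; apply: differentiable_continuous; apply/derivable1_diffP.
Qed.

Let FE (x : R) : 0 <= x -> \int[leb]_(u in `[0%R, x]) f u = F x - F 0.
Proof.
move=> x0; rewrite /F Rintegral_itvB//.
  rewrite Rintegral_itv_obnd_cbnd//.
  by apply: integrableS (integrable_f 0 x) => //; apply: subset_itvr; rewrite bnd_simp.
by rewrite bnd_simp; lra.
Qed.

(** By the mean value theorem the integral over a cell is [h * f c], and both endpoint values are
    within [e] of [f c]; each cell contributes at most [h * e]. *)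
Lemma trapezoid_error (x e dlt h : R) (K : nat) : 0 < e -> 0 < h -> h < dlt ->
  (forall s t, 0 <= s <= x -> `|t - s| < dlt -> `|f t - f s| < e) ->
  K%:R * h <= x ->
  `|\sum_(k < K) (h * (f (k%:R * h) + f (k.+1%:R * h)) / 2) -
    \int[leb]_(u in `[0%R, K%:R * h]) f u| <= K%:R * h * e.
Proof.
move=> e0 h0 hd fe; elim: K => [_|K IH Kx].
  rewrite big_ord0 mul0r mul0r sub0r normrN.
  by rewrite set_itv1 Rintegral_set1 normr0.
have SK : K.+1%:R * h = K%:R * h + h by rewrite -natr1 mulrDl mul1r.
have K0 : 0 <= K%:R * h by rewrite mulr_ge0// ltW.
have Kx' : K%:R * h <= x by rewrite SK in Kx; lra.
have [c] : exists2 c, c \in `]K%:R * h, K.+1%:R * h[%R &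
    F (K.+1%:R * h) - F (K%:R * h) = f c * (K.+1%:R * h - K%:R * h).
  apply: MVT; first by rewrite SK ltrDl.
    move=> c; rewrite in_itv/= => /andP[cK _].
    have [dF <-] : derivable F c 1 /\ F^`()%classic c = f c by apply: F_derive; lra.
    by rewrite derive1E; exact: DeriveDef.
  apply: continuous_in_subspaceT => c; rewrite inE/= in_itv/= => /andP[cK _].
  by apply: F_cont; lra.
rewrite in_itv/= => /andP[cK cSK] Fc.
have {}IH := IH Kx'.
rewrite FE// in IH; rewrite FE; last by rewrite SK; lra.
rewrite big_ord_recr/=.
set S := \sum_(k < K) _ in IH *.
have -> : S + h * (f (K%:R * h) + f (K.+1%:R * h)) / 2 - (F (K.+1%:R * h) - F 0) =
   (S - (F (K%:R * h) - F 0)) +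
   h * (- (f c - f (K%:R * h)) - (f c - f (K.+1%:R * h))) / 2.
  have -> : F (K.+1%:R * h) = F (K%:R * h) + f c * h.
    by rewrite -(subrK (F (K%:R * h)) (F _)) Fc addrC; congr (_ + _ * _); rewrite SK; ring.
  by field.
rewrite (le_trans (ler_normD _ _))// SK mulrDl lerD//.
have f1 : `|f c - f (K%:R * h)| < e.
  apply: fe; first by rewrite K0.
  by rewrite gtr0_norm ?subr_gt0//; rewrite SK in cSK; lra.
have f2 : `|f c - f (K%:R * h + h)| < e.
  apply: fe; first by rewrite -SK Kx andbT SK; lra.
  by rewrite ltr0_norm ?subr_lt0 -?SK//; lra.
rewrite !normrM gtr0_norm// -mulrA ler_pM2l// normfV [`|2|]ger0_norm// ler_pdivrMr//.
rewrite (le_trans (ler_normB _ _))// normrN; lra.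
Qed.

Lemma trapezoid_cvg (x : R) (h : nat -> R) (K : nat -> nat) : 0 <= x ->
  (forall p, 0 < h p) -> h p @[p --> \oo] --> (0 : R) ->
  (\forall p \near \oo, `|(K p)%:R * h p - x| <= h p) ->
  \sum_(k < K p) (h p * (f (k%:R * h p) + f (k.+1%:R * h p)) / 2) @[p --> \oo] -->
  \int[leb]_(u in `[0%R, x]) f u.
Proof.
move=> x0 h0 hcvg Kx.
have Khx := cvg_dist_le hcvg Kx.
have I_cvg : \int[leb]_(u in `[0%R, (K p)%:R * h p]) f u @[p --> \oo] -->
    \int[leb]_(u in `[0%R, x]) f u.
  rewrite FE//; under eq_fun do rewrite FE ?mulr_ge0 ?(ltW (h0 _))//.
  apply: cvgB; last exact: cvg_cst.
  apply: (cvg_comp (fun p => (K p)%:R * h p) F Khx).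
  by apply: F_cont; lra.
rewrite -[X in _ --> X]add0r.
rewrite (_ : (fun p => _) = fun p =>
    (\sum_(k < K p) (h p * (f (k%:R * h p) + f (k.+1%:R * h p)) / 2) -
     \int[leb]_(u in `[0%R, (K p)%:R * h p]) f u) +
    \int[leb]_(u in `[0%R, (K p)%:R * h p]) f u); last first.
  by apply/funext => p; rewrite subrK.
apply: cvgD => //.
apply/cvgr0Pnorm_le => e e0.
(* The last grid point may exceed [x] by one mesh, which is eventually below 1: hence [x + 1], both
   as the range of uniform continuity and as the bound on the total length. *)
have e'0 : 0 < e / (x + 1) by rewrite divr_gt0// ltr_wpDl.
have [dlt dlt0 fd] := heine_cantor 0 (x + 1) cf e'0.
have m0 : 0 < Num.min dlt 1 by rewrite lt_min dlt0/=.
near=> p.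
have : `|0 - h p| < Num.min dlt 1.
  by near: p; move: hcvg => /cvgrPdist_lt; exact.
rewrite sub0r normrN gtr0_norm// lt_min => /andP[hd h1].
have Kx1 : (K p)%:R * h p <= x + 1.
  have : `|(K p)%:R * h p - x| <= h p by near: p.
  rewrite ler_norml => /andP[_]; lra.
rewrite (le_trans (trapezoid_error e'0 (h0 p) hd fd Kx1))//.
by rewrite mulrA ler_pdivrMr ?ltr_wpDl// mulrC ler_pM2l.
Unshelve. all: by end_near. Qed.
End trapezoid_rule.

(** * Stopping times and domination *)

(** The maximum of [X] and [Y] lies above [X] everywhere and equals [Y] almost everywhere. *)
Lemma Ex_le_ae d (T : measurableType d) (R : realType) (P : probability T R)
    (X Y : T -> R) : L1 P X -> L1 P Y -> {ae P, forall w, X w <= Y w} ->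
  Ex P X <= Ex P Y.
Proof.
move=> X1 Y1 XY.
have mM : measurable_fun setT (fun w => Num.max (X w) (Y w)).
  by apply: measurable_maxr; [exact: (L1_measurable X1)|exact: (L1_measurable Y1)].
have M1 : L1 P (fun w => Num.max (X w) (Y w)).
  apply: (L1_le mM (L1_add (L1_norm X1) (L1_norm Y1))) => w.
  rewrite [leRHS]ger0_norm ?addr_ge0//.
  by have [_|_] := leP (X w) (Y w); rewrite ?lerDl ?lerDr normr_ge0.
rewrite -(@Ex_ae _ _ _ P (fun w => Num.max (X w) (Y w)) Y); last first.
  by apply: filterS XY => w XYw; rewrite max_r.
by apply: Ex_le => // w; rewrite le_max lexx.
Qed.

Lemma limn_einf_ge (R : realType) (u : nat -> \bar R) (l : \bar R) N :
  (forall n, (N <= n)%N -> (l <= u n)%E) -> (l <= limn_einf u)%E.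
Proof.
move=> lu; rewrite limn_einf_lim; apply: lime_ge; first exact: is_cvg_einfs.
exists N => // n /= Nn; apply: le_ereal_inf_tmp => _ [k /= nk <-].
by apply: lu; exact: leq_trans nk.
Qed.

Lemma limn_einf_le (R : realType) (u : nat -> \bar R) (l : \bar R) :
  (forall n, (u n <= l)%E) -> (limn_einf u <= l)%E.
Proof.
move=> ul; rewrite limn_einf_lim; apply: lime_le; first exact: is_cvg_einfs.
apply: nearW => n; apply: le_trans (ul n); apply: ereal_inf_lbound.
by exists n => /=.
Qed.

(** [Y] is the limit inferior, integrable by Fatou and hence almost surely finite. The null set does
    not depend on [b] and [N], so one [Y] serves all grid points at once. *)
Lemma fatou_L1 d (T : measurableType d) (R : realType) (P : probability T R)
    (u : nat -> T -> R) (C : R) :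
  (forall p, L1 P (u p)) -> (forall p w, 0 <= u p w) ->
  (forall p, Ex P (u p) <= C) ->
  exists Y : T -> R, L1 P Y /\
    {ae P, forall w (b : R) N, (forall p, (N <= p)%N -> b <= u p w) -> b <= Y w}.
Proof.
move=> u1 u0 uC.
pose Yb w := limn_einf (fun p => (u p w)%:E).
have mu p : measurable_fun setT (fun w => (u p w)%:E).
  by apply/measurable_EFinP; exact: L1_measurable.
have mY : measurable_fun setT Yb.
  rewrite /Yb /limn_einf; apply: measurableT_comp => //.
  apply: measurable_fun_limn_esup => p.
  exact: measurableT_comp.
have Y0 w : (0 <= Yb w)%E by apply: (@limn_einf_ge _ _ _ 0) => p _; rewrite lee_fin.
have iY : P.-integrable setT Yb.
  apply/integrableP; split => //.
  under eq_integral do rewrite gee0_abs//.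
  apply: (@le_lt_trans _ _ C%:E); last exact: ltry.
  apply: (le_trans (fatou P measurableT mu _)).
    by move=> p w _; rewrite lee_fin.
  apply: limn_einf_le => p.
  by have := ExE (u1 p); rewrite unlock => ->; rewrite lee_fin.
exists (fine \o Yb); split.
  apply/integrableP; split.
    by apply/measurable_EFinP; apply: measurableT_comp.
  have /integrableP[_] := iY; apply: le_lt_trans; rewrite le_eqVlt.
  apply/orP; left; apply/eqP; apply: ae_eq_integral => //.
  - by apply: measurableT_comp => //; apply/measurable_EFinP; apply: measurableT_comp.
  - exact: measurableT_comp.
  - by apply: filterS (integrable_ae measurableT iY) => w /(_ I) fY _; congr abse; exact: fineK.
apply: filterS (integrable_ae measurableT iY) => w /(_ I) fY b N bN /=.
by rewrite -lee_fin fineK//; apply: (@limn_einf_ge _ _ _ N) => p Np; rewrite lee_fin bN.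
Qed.

(** For [h > 0], the index of the first grid point not before [x], capped at [m]. *)
Fixpoint gridK (R : realType) (x h : R) (m : nat) : nat :=
  if m is j.+1 then if j%:R * h < x then j.+1 else gridK x h j else 0%N.

Lemma gridK_le (R : realType) (x h : R) m : (gridK x h m <= m)%N.
Proof. by elim: m => //= m IH; case: ifP => // _; exact: leqW. Qed.

Lemma ltn_gridK (R : realType) (x h : R) m k : 0 <= h -> (k < m)%N ->
  (k < gridK x h m)%N = (k%:R * h < x).
Proof.
move=> h0; elim: m => //= m IH; have [mx|xm] := ltP (m%:R * h) x.
  move=> km; rewrite km; apply/esym/(le_lt_trans _ mx).
  by rewrite ler_wpM2r// ler_nat -ltnS.
rewrite ltnS leq_eqVlt => /predU1P[->|]; last exact: IH.
by rewrite ltNge xm/= ltnNge gridK_le.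
Qed.

(** Passes between the two views of a stopped sum: random weights over a fixed range, suited to
    expectations, and a range depending on the path, suited to limits. *)
Lemma sum_gridK (R : realType) (x h : R) m (g : nat -> R) : 0 <= h ->
  \sum_(k < m) (k%:R * h < x)%R%:R * g k = \sum_(k < gridK x h m) g k.
Proof.
move=> h0; rewrite (big_ord_widen m)//; last exact: gridK_le.
rewrite [RHS]big_mkcond/=; apply: eq_bigr => k _.
by rewrite ltn_gridK//; case: ifP; rewrite ?mul1r ?mul0r.
Qed.

Lemma gridK_ub (R : realType) (x h : R) m : 0 <= h -> 0 <= x ->
  (gridK x h m)%:R * h <= x + h.
Proof.
move=> h0 x0; case E : (gridK x h m) => [|k]; first by rewrite mul0r addr_ge0.
have : (k < gridK x h m)%N by rewrite E.
rewrite ltn_gridK//; last by rewrite (leq_trans _ (gridK_le x h m))// E.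
by move=> /ltW kx; rewrite -natr1 mulrDl mul1r lerD2r.
Qed.

Lemma gridK_lb (R : realType) (x h : R) m : 0 <= h -> x <= m%:R * h ->
  x <= (gridK x h m)%:R * h.
Proof.
move=> h0 xm; have := gridK_le x h m; rewrite leq_eqVlt => /predU1P[->//|Km].
by rewrite leNgt -(ltn_gridK _ h0 Km) ltnn.
Qed.

Lemma gridK_lt1 (R : realType) (x h : R) m k : 0 < h <= 1 -> 0 <= x ->
  (k <= gridK x h m)%N -> k%:R * h < x + 1.
Proof.
move=> /andP[h0 h1] x0; case: k => [|k] kK; first by rewrite mul0r ltr_wpDl.
have : k%:R * h < x.
  by rewrite -(@ltn_gridK _ _ _ m) ?ltW// (leq_trans kK)// gridK_le.
rewrite -natr1 mulrDl mul1r; lra.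
Qed.

Lemma telescope_gridK (R : realType) (x h : R) m (f : nat -> R) : 0 <= h ->
  \sum_(k < m) (k%:R * h < x)%R%:R * (f k.+1 - f k) = f (gridK x h m) - f 0%N.
Proof.
move=> h0; rewrite (@sum_gridK _ _ _ _ (fun k => f k.+1 - f k))//.
by rewrite -(big_mkord xpredT (fun k => f k.+1 - f k)) telescope_sumr.
Qed.

(** Paths are continuous on [[0, +oo[] only; freezing them at negative times gives functions on the
    whole line to which the trapezoidal rule applies. *)
Lemma continuous_max0 (R : realType) (g : R -> R) :
  {within `[0, +oo[, continuous g} -> continuous (fun t : R => g (Num.max t 0)).
Proof.
move=> /subspace_continuousP cg t.
have m0 s : `[0, +oo[%classic (Num.max s 0 : R).
  by rewrite /= in_itv/= andbT le_max lexx orbT.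
apply: (cvg_comp (fun s => Num.max s 0) g _ (cg _ (m0 t))).
have cm : Num.max s 0 @[s --> t] --> Num.max t 0.
  by apply: (@continuous_max _ _ id (cst 0)); [exact: cvg_id|exact: cvg_cst].
move=> U; rewrite /within /= => mU.
have mUt : \forall s \near t, Num.max s 0 \in `[0, +oo[ -> U (Num.max s 0).
  exact: (cm _ mU).
have : \forall s \near t, U (Num.max s 0).
  near=> s; have : Num.max s 0 \in `[0, +oo[ -> U (Num.max s 0) by near: s.
  by apply; exact: m0.
exact.
Unshelve. all: by end_near.
Qed.

Lemma cvg_sumr (R : realType) (S : Type) (F : set_system S) (FF : Filter F)
    (n : nat) (f : 'I_n -> S -> R) (a : 'I_n -> R) :
  (forall i, f i x @[x --> F] --> a i) ->
  \sum_(i < n) f i x @[x --> F] --> \sum_(i < n) a i.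
Proof.
elim: n f a => [|n IH] f a fa.
  by rewrite big_ord0; under eq_fun do rewrite big_ord0; exact: cvg_cst.
rewrite (_ : (fun x => _) = fun x =>
    \sum_(i < n) f (widen_ord (leqnSn n) i) x + f ord_max x); last first.
  by apply/funext => u; rewrite big_ord_recr.
by rewrite big_ord_recr/=; apply: cvgD; [apply: IH => i; exact: fa|exact: fa].
Qed.

Lemma Rintegral_sum_continuous (R : realType) (n : nat) (f : 'I_n -> R -> R) (x : R) :
  (forall i, continuous (f i)) ->
  \sum_(i < n) \int[@lebesgue_measure R]_(u in `[0%R, x]) f i u =
  \int[@lebesgue_measure R]_(u in `[0%R, x]) \sum_(i < n) f i u.
Proof.
move=> cf.
have int (g : R -> R) : continuous g ->
    (@lebesgue_measure R).-integrable `[0%R, x] (EFin \o g).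
  move=> cg; apply: continuous_compact_integrable; first exact: segment_compact.
  exact: continuous_subspaceT.
elim: n f cf => [|n IH] f cf.
  rewrite big_ord0; under eq_Rintegral do rewrite big_ord0.
  by rewrite Rintegral_cst// mul0r.
rewrite big_ord_recr/= IH//; under [RHS]eq_Rintegral do rewrite big_ord_recr/=.
rewrite RintegralD//; apply: int => // t.
by apply: cvg_sumr => i; exact: cf.
Qed.

(** * Stopping times of the Brownian filtration *)

Section stopping.
Context d (T : measurableType d) (R : realType) (P : probability T R) (n : nat).
Variable B : 'I_n -> R -> {RV P >-> R}.
Implicit Type tau : T -> \bar R.

(** Refers to the filtration of the Brownian motions; by [natural_filtration_past] it contains that
    of the [N i]. *)
Definition is_stopping tau : Prop := stopping_time (fun t => <<s past_gens B t >>) tau.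

Lemma natural_filtration_past (D sigma : 'I_n -> R) (N : 'I_n -> R -> T -> R) :
  (forall i t w, N i t w = D i * t + sigma i * B i t w) ->
  forall t, natural_filtration N t `<=` <<s past_gens B t >>.
Proof.
move=> hN t; apply: sigma_generated_le; first exact: sigma_generated_sigma_algebra.
move=> [i s] U /= st mU; rewrite -[_ @^-1` _]setTI.
have -> : N i s = fun w => D i * s + sigma i * Bpair B (i, s) w.
  by apply/funext => w; rewrite hN.
suff mN : measurable_fun (setT : set (g_sigma_algebraType (past_gens B t)))
    (fun w => D i * s + sigma i * Bpair B (i, s) w) by exact: mN.
apply: measurable_funD => //; apply: measurable_funM => //.
exact: gens_measurable_fun.
Qed.

Lemma active_past tau (t : R) : is_stopping tau -> 0 <= t ->
  <<s past_gens B t >> [set w | (t%:E < tau w)%E].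
Proof.
move=> [tau0 st] t0.
have -> : [set w | (t%:E < tau w)%E] = ~` [set w | (tau w <= t%:E)%E].
  by apply/seteqP; split => w /=; rewrite ltNge => /negP.
by apply: sigma_algebraC; exact: st.
Qed.

Lemma stopping_add1 tau : is_stopping tau -> is_stopping (fun w => tau w + 1)%E.
Proof.
move=> [tau0 st]; split => [w|t t0]; first by rewrite adde_ge0.
have [t1|t1] := leP 1 t.
  have -> : [set w | (tau w + 1 <= t%:E)%E] = [set w | (tau w <= (t - 1)%:E)%E].
    by apply/seteqP; split => w /=; rewrite EFinB leeBrDr.
  by apply: (@past_gens_le _ _ _ _ _ B (t - 1)); [lra|apply: st; lra].
have -> : [set w | (tau w + 1 <= t%:E)%E] = set0.
  apply/seteqP; split => w //=; apply/negP; rewrite -ltNge.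
  by rewrite (@lt_le_trans _ _ 1%E)// ?lte_fin// leeDr.
exact: sigma_algebra0.
Qed.

Lemma stopping_measurable tau : is_stopping tau -> measurable_fun setT tau.
Proof.
move=> st; have [tau0 _] := st.
move=> mT; apply: (measurability _ (ErealGenOInfty.measurableE R)) => // _ [_ [t ->] <-].
rewrite setTI.
have [t0|t0] := leP 0 t.
  rewrite (_ : _ @^-1` _ = [set w | (t%:E < tau w)%E]).
    exact: past_gens_measurable (active_past st t0).
  by apply/seteqP; split => w /=; rewrite in_itv/= andbT.
rewrite (_ : _ @^-1` _ = setT)//; apply/seteqP; split => w //= _.
by rewrite in_itv/= andbT (lt_le_trans _ (tau0 w))// lte_fin.
Qed.

Lemma stopping_L2 tau : is_stopping tau -> (\int[P]_w (tau w ^+ 2) < +oo)%E ->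
  L2 P (fun w => fine (tau w)) /\ {ae P, forall w, tau w = (fine (tau w))%:E}.
Proof.
move=> st tau2; have mtau := stopping_measurable st.
have [tau0 _] := st.
have mtau2 : measurable_fun setT (fun w => tau w ^+ 2)%E.
  by under eq_fun do rewrite expe2; exact: emeasurable_funM.
have i2 : P.-integrable setT (fun w => tau w ^+ 2)%E.
  apply/integrableP; split; first exact: mtau2.
  by under eq_integral do rewrite gee0_abs ?expe_ge0//.
have fin_tau : {ae P, forall w, tau w = (fine (tau w))%:E}.
  apply: filterS (integrable_ae measurableT i2) => w /(_ I).
  move: (tau0 w); case: (tau w) => //= _.
have mx : measurable_fun setT (fun w => fine (tau w)).
  by apply: measurableT_comp mtau; exact: fine_measurable.
split=> //; split=> //.
apply/integrableP; split; first by apply/measurable_EFinP; exact: measurable_funX.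
have /integrableP[_] := i2; apply: le_lt_trans; rewrite le_eqVlt.
apply/orP; left; apply/eqP; apply: ae_eq_integral => //.
- by apply: measurableT_comp => //; apply/measurable_EFinP; exact: measurable_funX.
- by apply: measurableT_comp => //; exact: mtau2.
- by apply: filterS fin_tau => w fw _ /=; rewrite [in RHS]fw.
Qed.
End stopping.

(** * An integrable bound common to all dyadic grids *)

Section dominating.
Context d (T : measurableType d) (R : realType) (P : probability T R) (n : nat).
Variable B : 'I_n -> R -> {RV P >-> R}.
Hypothesis hB : forall i, standard_brownian_motion P (B i).
Hypothesis hindep : independent_processes P (fun i t => B i t : T -> R).
Variable c : 'I_n -> R.
Variable tau : T -> \bar R.
Hypothesis st : is_stopping B tau.
Hypothesis tau2 : (\int[P]_w (tau w ^+ 2) < +oo)%E.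

Definition mesh (p : nat) : R := (2 ^+ p)^-1.
(** The grid of mesh [2^-p] then covers [[0, p]], so the deterministic cut-off tends to infinity as
    the mesh tends to 0. *)
Definition steps (p : nat) : nat := (p * 2 ^ p)%N.

Lemma mesh_gt0 p : 0 < mesh p.
Proof. by rewrite invr_gt0 exprn_gt0. Qed.

Lemma mesh_le1 p : mesh p <= 1.
Proof. by rewrite invf_le1 ?exprn_gt0// exprn_ege1// ler1n. Qed.

Lemma steps_mesh p : (steps p)%:R * mesh p = p%:R.
Proof. by rewrite natrM natrX mulfK// expf_neq0. Qed.

Lemma refine_mesh p q k : (p <= q)%N -> (k * 2 ^ (q - p))%:R * mesh q = k%:R * mesh p.
Proof.
move=> pq; rewrite natrM natrX /mesh -{2}(subnKC pq) exprD.
by field; rewrite !expf_neq0.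
Qed.

Lemma bm_comb0_ae : {ae P, forall w, bm_comb B c 0 w = 0}.
Proof.
have B0 : {ae P, forall w, forall i, B i 0 w = 0}.
  by apply: filter_forall => i; exact: bm_start (hB i).
by apply: filterS B0 => w B0; rewrite /bm_comb big1// => i _; rewrite B0 mulr0.
Qed.

(* The extra unit of time covers the grid points up to the first one after
   [tau]. *)
Let active p k := [set w | ((k%:R * mesh p)%:E < tau w + 1)%E].

Let active_GA p k : <<s past_gens B (k%:R * mesh p) >> (active p k).
Proof.
apply: (active_past (stopping_add1 st)).
by rewrite mulr_ge0// ltW// mesh_gt0.
Qed.

Let activeE p k w : tau w = (fine (tau w))%:E ->
  \1_(active p k) w = (k%:R * mesh p < fine (tau w) + 1)%R%:R :> R.
Proof.
move=> fw; rewrite indicE; congr (_%:R); congr nat_of_bool.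
by apply/idP/idP; rewrite inE /active/= fw -EFinD lte_fin.
Qed.

Lemma dominating : exists Y : T -> R, L1 P Y /\
  {ae P, forall w p k, k%:R * mesh p < fine (tau w) + 1 ->
    bm_comb B c (k%:R * mesh p) w ^+ 2 <= Y w}.
Proof.
have [x2 tau_fin] := stopping_L2 st tau2.
have x1 := L2_L1 x2.
have s20 : 0 <= comb_variance c by apply: sumr_ge0 => i _; exact: sqr_ge0.
have mA p k : measurable (active p k) by apply: past_gens_measurable; exact: active_GA.
pose u p w := running_max (stopped B c (mesh p) (active p) ^~ w) (steps p) ^+ 2.
(* The mesh times the number of active steps is at most [tau + 1] plus one mesh, hence at most
   [tau + 2]. *)
have [//|||Y [Y1 Yu]] := @fatou_L1 _ _ _ P u
  (4 * (comb_variance c * Ex P (fun w => fine (tau w) + 2))).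
- by move=> p; exact: (doob hB hindep c (mesh_gt0 p) (@active_GA p) (steps p)).1.
- by move=> p w; exact: sqr_ge0.
- move=> p; apply: le_trans (doob hB hindep c (mesh_gt0 p) (@active_GA p) (steps p)).2 _.
  rewrite ler_pM2l// -mulrA ler_wpM2l// -Ex_sum; last first.
    by move=> k; exact: integrable_indic.
  have I1 : L1 P (fun w => \sum_(k < steps p) \1_(active p k) w : R).
    by apply: L1_sum => k _; exact: integrable_indic.
  rewrite -Ex_scale//; apply: Ex_le_ae; first exact: L1_scale.
    by apply: L1_add => //; exact: L1_cst.
  apply: filterS tau_fin => w fw.
  under eq_bigr do rewrite activeE// -[_%:R]mulr1.
  rewrite (@sum_gridK _ _ _ _ (fun=> 1)) ?(ltW (mesh_gt0 p))//.
  rewrite sumr_const card_ord mulrC.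
  have x0 : 0 <= fine (tau w) + 1 by rewrite addr_ge0// fine_ge0//; exact: st.1.
  apply: (le_trans (gridK_ub _ (ltW (mesh_gt0 p)) x0)).
  by have := mesh_le1 p; lra.
exists Y; split => //; apply: filterS3 Yu tau_fin bm_comb0_ae => w Yu fw M0 p k kx.
(* [q >= p] makes the grid of level [q] contain the given point, and [q >= k] places its index
   [k * 2^(q - p)] within the [steps q] steps. *)
apply: (Yu _ (p + k)%N) => q pkq.
have pq : (p <= q)%N by apply: leq_trans pkq; exact: leq_addr.
pose j := (k * 2 ^ (q - p))%N.
have jE : j%:R * mesh q = k%:R * mesh p by exact: refine_mesh.
have jq : (j <= steps q)%N.
  rewrite /steps leq_mul//; first by rewrite (leq_trans _ pkq)// leq_addl.
  by rewrite leq_pexp2l// leq_subr.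
have SE : stopped B c (mesh q) (active q) j w = bm_comb B c (k%:R * mesh p) w.
  pose dM i := bm_comb_incr B c (i%:R * mesh q) (i.+1%:R * mesh q) w.
  rewrite /stopped (eq_bigr (fun i : 'I_j => dM i)).
    rewrite -(big_mkord xpredT dM).
    rewrite (telescope_sumr (fun i => bm_comb B c (i%:R * mesh q) w))//.
    by rewrite mul0r M0 subr0 jE.
  move=> i _; rewrite activeE//.
  have -> : i%:R * mesh q < fine (tau w) + 1.
    by rewrite (le_lt_trans _ kx)// -jE ler_pM2r ?mesh_gt0// ler_nat ltnW.
  by rewrite mul1r.
rewrite -SE /u -(real_normK (num_real (stopped _ _ _ _ _ _))).
rewrite lerXn2r ?nnegrE ?running_max_ge0//.
by apply: running_max_ge => //; exact: stopped0.
Qed.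

End dominating.

(** * Passage to the limit *)

Section path_limits.
Variables (R : realType) (g : R -> R) (x C : R).
Hypotheses (x0 : 0 <= x) (cg : {within `[0, +oo[, continuous g}).
Hypothesis gC : forall p k, k%:R * mesh R p < x + 1 -> g (k%:R * mesh R p) ^+ 2 <= C.

Let h := mesh R.
Let m := steps.
Let K p := gridK x (h p) (m p).

Let h0 p : 0 <= h p. Proof. exact/ltW/mesh_gt0. Qed.

Let h_cvg : h p @[p --> \oo] --> (0 : R).
Proof.
rewrite (_ : (fun p => h p) = fun p => 2^-1 ^+ p); last first.
  by apply/funext => p; rewrite exprVn.
by apply: cvg_expr; rewrite ger0_norm ?invr_ge0// invf_lt1// ltr1n.
Qed.

Let K_near : \forall p \near \oo, `|(K p)%:R * h p - x| <= h p.
Proof.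
near=> p; have Kub := gridK_ub (m p) (h0 p) x0.
(* The grid reaches time [p], so the cap in [gridK] is harmless once [p >= x]. *)
have xp : x <= (m p)%:R * h p.
  by rewrite steps_mesh; near: p; exact: nbhs_infty_ger.
have := gridK_lb (h0 p) xp; rewrite -/(K p) => Klb.
by rewrite ger0_norm ?subr_ge0// lerBlDl.
Unshelve. all: by end_near. Qed.

Let gm t := g (Num.max t 0).
Let cgm : continuous gm. Proof. exact: continuous_max0. Qed.
Let gmE t : 0 <= t -> gm t = g t.
Proof. by move=> t0; rewrite /gm max_l. Qed.
Let kh0 p k : 0 <= k%:R * h p. Proof. by rewrite mulr_ge0. Qed.

Lemma telescope_path_cvg (f : R -> R) : continuous f ->
  \sum_(k < m p) (k%:R * h p < x)%R%:R *
    (f (g (k.+1%:R * h p)) - f (g (k%:R * h p))) @[p --> \oo] -->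
  f (g x) - f (g 0).
Proof.
move=> cf; under eq_fun do
  rewrite (telescope_gridK _ _ (fun k => f (g (k%:R * h _))))// mul0r.
apply: cvgB; last exact: cvg_cst.
rewrite -(gmE x0) (_ : (fun p => _) = fun p => f (gm ((K p)%:R * h p))); last first.
  by apply/funext => p; rewrite gmE.
apply: (cvg_comp (fun p => gm ((K p)%:R * h p)) f); last exact: cf.
by apply: (cvg_comp _ gm (cvg_dist_le h_cvg K_near)); exact: cgm.
Qed.

Lemma trapezoid_path_cvg :
  \sum_(k < m p) (k%:R * h p < x)%R%:R *
    (h p * (g (k%:R * h p) + g (k.+1%:R * h p)) / 2) @[p --> \oo] -->
  \int[@lebesgue_measure R]_(u in `[0%R, x]) g u.
Proof.
have -> : \int[@lebesgue_measure R]_(u in `[0%R, x]) g u =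
    \int[@lebesgue_measure R]_(u in `[0%R, x]) gm u.
  apply: eq_Rintegral => u; rewrite inE/= in_itv/= => /andP[u0 _].
  by rewrite gmE.
have := trapezoid_cvg cgm x0 (mesh_gt0 R) h_cvg K_near.
apply: cvg_trans; apply: near_eq_cvg; apply: nearW => p.
rewrite (@sum_gridK _ _ _ _ (fun k => h p * (g (k%:R * h p) + g (k.+1%:R * h p)) / 2))//.
by apply: eq_bigr => k _; rewrite !gmE.
Qed.

Let g_le p k : (k <= K p)%N -> g (k%:R * h p) ^+ 2 <= C.
Proof.
by move=> kK; apply: gC; apply: (@gridK_lt1 _ _ _ (m p)); rewrite ?mesh_gt0 ?mesh_le1.
Qed.

Lemma telescope_pathE (f : R -> R) p :
  \sum_(k < m p) (k%:R * h p < x)%R%:R *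
    (f (g (k.+1%:R * h p)) - f (g (k%:R * h p))) = f (g ((K p)%:R * h p)) - f (g 0).
Proof. by rewrite (telescope_gridK _ _ (fun k => f (g (k%:R * h _))))// mul0r. Qed.

Lemma stopped_path_le p : g ((K p)%:R * h p) ^+ 2 <= C.
Proof. exact: g_le. Qed.

(** Each cell contributes at most [h * sqrt C] and the cells have total length at most [x + 1]; then
    [a b <= a^2 + b^2]. The bound does not involve [p], as domination demands. *)
Lemma trapezoid_path_le p :
  `|\sum_(k < m p) (k%:R * h p < x)%R%:R *
    (h p * (g (k%:R * h p) + g (k.+1%:R * h p)) / 2)| <= (x + 1) ^+ 2 + C.
Proof.
have g_sqrt k : (k <= K p)%N -> `|g (k%:R * h p)| <= Num.sqrt C.
  by move=> kK; rewrite -sqrtr_sqr ler_wsqrtr// g_le.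
have C0 : 0 <= C by apply: le_trans (g_le (leqnn (K p))); exact: sqr_ge0.
rewrite (@sum_gridK _ _ _ _ (fun k => h p * (g (k%:R * h p) + g (k.+1%:R * h p)) / 2))//.
apply: le_trans (ler_norm_sum _ _ _) _.
apply: (@le_trans _ _ (\sum_(k < K p) h p * Num.sqrt C)).
  apply: ler_sum => k _; rewrite -mulrA normrM ger0_norm// ler_wpM2l//.
  rewrite normrM normfV [`|2|]ger0_norm// ler_pdivrMr//.
  rewrite (le_trans (ler_normD _ _))// mulr_natr mulr2n lerD//; apply: g_sqrt => //.
  exact: ltnW.
rewrite sumr_const card_ord -mulr_natl mulrA.
have Kx : (K p)%:R * h p <= x + 1.
  by rewrite (le_trans (gridK_ub _ (h0 p) x0))// lerD2l mesh_le1.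
apply: (@le_trans _ _ ((x + 1) * Num.sqrt C)).
  by rewrite ler_wpM2r// sqrtr_ge0.
have := sqr_sqrtr C0; have := sqr_ge0 (x + 1 - Num.sqrt C).
have := sqr_ge0 (x + 1 + Num.sqrt C); nra.
Qed.

End path_limits.
Theorem proposition19 (R : realType) (d : measure_display)
    (T : measurableType d) (P : probability T R) (n : nat) (hn : (1 <= n)%N)
    (B : 'I_n -> R -> {RV P >-> R})
    (hB : forall i, standard_brownian_motion P (B i))
    (hindep : independent_processes P (fun i t => B i t : T -> R))
    (D sigma omega : 'I_n -> R)
    (hD : forall i, 0 < D i) (hsigma : forall i, 0 < sigma i)
    (homega : forall i, 0 < omega i)
    (N : 'I_n -> R -> T -> R)
    (hN : forall i t w, N i t w = D i * t + sigma i * B i t w)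
    (tau : T -> \bar R)
    (htau : stopping_time (natural_filtration N) tau)
    (htau2 : (\int[P]_w (tau w ^+ 2) < +oo)%E) :
  let cost := fun w : T =>
    \sum_(i < n) \int[lebesgue_measure]_(u in `[0, fine (tau w)])
      (omega i * N i u w) in
  let workload := fun w : T => \sum_(i < n) omega i * N i (fine (tau w)) w in
  [/\ ae_integrable P cost,
      ae_integrable P (fun w => workload w ^+ 2),
      ae_integrable P workload &
      ('E_P[cost] =
         (1 / (2 * \sum_(i < n) omega i * D i))%:E
           * 'E_P[fun w => (workload w ^+ 2)%R]
         - ((\sum_(i < n) omega i ^+ 2 * sigma i ^+ 2)
              / (2 * (\sum_(i < n) omega i * D i) ^+ 2))%:E
           * 'E_P[workload])%E].
Proof.
move=> cost workload.
pose c i := omega i * sigma i.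
pose mu := \sum_(i < n) omega i * D i.
have mu0 : 0 < mu.
  rewrite /mu (bigD1 (Ordinal hn))//= ltr_wpDr ?mulr_gt0//.
  by apply: sumr_ge0 => i _; rewrite mulr_ge0 ?ltW.
have st : is_stopping B tau.
  have [tau0 tst] := htau; split => // t t0.
  exact: natural_filtration_past hN _ _ (tst t t0).
have [x2 tau_fin] := stopping_L2 st htau2.
have [Y [Y1 MY]] := dominating hB hindep c st htau2.
pose x w := fine (tau w).
have x0 w : 0 <= x w by rewrite fine_ge0//; exact: st.1.
have WE t w : drifted B c mu t w = \sum_(i < n) omega i * N i t w.
  rewrite /drifted /bm_comb /mu mulr_suml -big_split/=; apply: eq_bigr => i _.
  by rewrite hN /c; ring.
(* From [(a + b)^2 <= 2 a^2 + 2 b^2], with [a] the drift at a time before [tau + 1] and [b] the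
   martingale part. *)
pose C w := 2 * mu ^+ 2 * (x w + 1) ^+ 2 + 2 * Y w.
pose A p k := [set w | ((k%:R * mesh R p)%:E < tau w)%E].
have A_past p k : <<s past_gens B (k%:R * mesh R p) >> (A p k).
  by apply: (active_past st); rewrite mulr_ge0// ltW// mesh_gt0.
have A_E w p k : tau w = (x w)%:E ->
    \1_(A p k) w = (k%:R * mesh R p < x w)%R%:R :> R.
  move=> fw; rewrite indicE; congr (_%:R); congr nat_of_bool.
  by apply/idP/idP; rewrite inE /A/= fw lte_fin.
pose F1 p := trapezoid B c (mesh R p) (A p) mu (steps p).
pose F2 p := telescoped B c (mesh R p) (A p) mu (fun y => y ^+ 2) (steps p).
pose F3 p := telescoped B c (mesh R p) (A p) mu id (steps p).
have FP p := grid_identity hB hindep c (mesh_gt0 R p) (A_past p)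
  (lt0r_neq0 mu0) (steps p).
have F1_1 p : L1 P (F1 p) by have [] := FP p.
have F2_1 p : L1 P (F2 p) by have [] := FP p.
have F3_1 p : L1 P (F3 p) by have [] := FP p.
have F_E p : Ex P (F1 p) =
    1 / (2 * mu) * Ex P (F2 p) - comb_variance c / (2 * mu ^+ 2) * Ex P (F3 p).
  by have [] := FP p.
pose good w := [/\ tau w = (x w)%:E,
  {within `[0, +oo[, continuous (fun t => drifted B c mu t w)},
  forall i, {within `[0, +oo[, continuous (fun t => B i t w)},
  drifted B c mu 0 w = 0 &
  forall p k, k%:R * mesh R p < x w + 1 -> drifted B c mu (k%:R * mesh R p) w ^+ 2 <= C w].
have goodP : {ae P, forall w, good w}.
  have cB : {ae P, forall w i, {within `[0, +oo[, continuous (fun t => B i t w)}}.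
    by apply: filter_forall => i; exact: bm_continuous_paths (hB i).
  apply: filterS2 (filterI tau_fin cB) (filterI MY (bm_comb0_ae hB c)).
  move=> w [fw cBw] [MYw M0].
  split => //.
  - apply/subspace_continuousP => t t0.
    apply: cvgD; first by apply: cvgM; [exact: cvg_cst|exact: cvg_within].
    apply: cvg_sumr => i; apply: cvgM; first exact: cvg_cst.
    by have /subspace_continuousP := cBw i; apply.
  - by rewrite /drifted mulr0 add0r.
  - move=> p k kx; have := MYw p k kx; rewrite /C /drifted.
    have k0 : 0 <= k%:R * mesh R p by rewrite mulr_ge0// ltW// mesh_gt0.
    set t := k%:R * _ in kx k0 *; set z := bm_comb _ _ _ _ => zY.
    have a1 : (mu * t) ^+ 2 <= mu ^+ 2 * (x w + 1) ^+ 2.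
      by rewrite exprMn ler_wpM2l ?sqr_ge0// lerXn2r ?nnegrE ?(ltW kx)// addr_ge0.
    have := sqr_ge0 (mu * t - z); nra.
(* One function for the three limits: the trapezoid needs [(x + 1)^2 + C], the square needs [C], and
   the linear term uses [|y| <= 1 + y^2]. *)
pose dom w := 1 + (x w + 1) ^+ 2 + C w.
have x1 : L1 P (fun w => (x w + 1) ^+ 2).
  by have [] := L2_add x2 (L2_cst P 1).
have dom1 : L1 P dom.
  apply: L1_add; first by apply: L1_add => //; exact: L1_cst.
  by apply: L1_add; exact: L1_scale.
have lim2 (f : R -> R) w : continuous f -> f 0 = 0 -> good w ->
    telescoped B c (mesh R p) (A p) mu f (steps p) w @[p --> \oo] -->
    f (drifted B c mu (x w) w).
  move=> cf f0 [fw cW _ W0 WC].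
  have := telescope_path_cvg (x0 w) cW cf.
  rewrite W0 f0 subr0; apply: cvg_trans; apply: near_eq_cvg; apply: nearW => p.
  by apply: eq_bigr => k _; rewrite A_E.
(* On a good path the sum collapses to [f] at the workload [y] of the stopping grid point, which
   lies before [tau + 1]. *)
have telE (f : R -> R) w p : good w -> f 0 = 0 -> exists2 y, y ^+ 2 <= C w &
    telescoped B c (mesh R p) (A p) mu f (steps p) w = f y.
  move=> [fw cW _ W0 WC] f0.
  exists (drifted B c mu ((gridK (x w) (mesh R p) (steps p))%:R * mesh R p) w).
    exact: (stopped_path_le (g := drifted B c mu ^~ w) (x0 w) WC).
  rewrite -[RHS]subr0 -f0 -W0 -(telescope_pathE (drifted B c mu ^~ w)).
  by apply: eq_bigr => k _; rewrite A_E.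
have C0 w : good w -> 0 <= C w.
  move=> gw; have [y yC _] := telE id w 0%N gw erefl.
  exact: le_trans (sqr_ge0 y) yC.
have xx0 w : 0 <= (x w + 1) ^+ 2 by exact: sqr_ge0.
have [int1 fin1 cvg1] : [/\ ae_integrable P cost, 'E_P[cost]%E \is a fin_num &
    Ex P (F1 p) @[p --> \oo] --> fine 'E_P[cost]%E].
  apply: (ae_dominated _ dom1).
  - by move=> p; exact: L1_measurable (F1_1 p).
  - apply: filterS goodP => w gw p; have [fw cW _ W0 WC] := gw.
    apply: (@le_trans _ _ ((x w + 1) ^+ 2 + C w)); last by rewrite lerD2r lerDr.
    apply: le_trans (trapezoid_path_le (g := drifted B c mu ^~ w) (x0 w) WC p).
    rewrite le_eqVlt; apply/orP; left; apply/eqP; congr `|_|.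
    by apply: eq_bigr => k _; rewrite A_E.
  - apply: filterS goodP => w [fw cW cBw W0 WC].
    have -> : cost w = \int[@lebesgue_measure R]_(u in `[0%R, x w]) drifted B c mu u w.
      (* A continuous function on the whole line that agrees with the integrand on [[0, tau]], so
         that sum and integral can be exchanged. *)
      pose f i u := omega i * (D i * u + sigma i * B i (Num.max u 0) w).
      have cf i : continuous (f i).
        move=> u; apply: cvgM; first exact: cvg_cst.
        apply: cvgD; first by apply: cvgM; [exact: cvg_cst|exact: cvg_id].
        apply: cvgM; first exact: cvg_cst.
        exact: (continuous_max0 (cBw i)).
      have u0 u : u \in `[0%R, x w]%classic -> Num.max u 0 = u.
        by rewrite inE/= in_itv/= => /andP[u0 _]; rewrite max_l.
      transitivity (\sum_(i < n) \int[@lebesgue_measure R]_(u in `[0%R, x w]) f i u).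
        apply: eq_bigr => i _; apply: eq_Rintegral => u ux.
        by rewrite /f u0// hN.
      rewrite Rintegral_sum_continuous//; apply: eq_Rintegral => u ux.
      by rewrite WE; apply: eq_bigr => i _; rewrite /f u0// hN.
    have := trapezoid_path_cvg (x0 w) cW.
    apply: cvg_trans; apply: near_eq_cvg; apply: nearW => p.
    by apply: eq_bigr => k _; rewrite A_E.
have [int2 fin2 cvg2] : [/\ ae_integrable P (fun w => workload w ^+ 2),
    'E_P[fun w => (workload w ^+ 2)%R]%E \is a fin_num &
    Ex P (F2 p) @[p --> \oo] --> fine 'E_P[fun w => (workload w ^+ 2)%R]%E].
  apply: (ae_dominated _ dom1).
  - by move=> p; exact: L1_measurable (F2_1 p).
  - apply: filterS goodP => w gw p.
    rewrite /F2; have [|y yC ->] := telE (fun y => y ^+ 2) w p gw; first by rewrite expr0n.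
    rewrite ger0_norm ?sqr_ge0// (le_trans yC)// lerDr addr_ge0//.
  - apply: filterS goodP => w gw.
    rewrite /workload -WE; apply: (lim2 (fun y => y ^+ 2)) => //.
    + exact: exprn_continuous.
    + by rewrite expr0n.
have [int3 fin3 cvg3] : [/\ ae_integrable P workload, 'E_P[workload]%E \is a fin_num &
    Ex P (F3 p) @[p --> \oo] --> fine 'E_P[workload]%E].
  apply: (ae_dominated _ dom1).
  - by move=> p; exact: L1_measurable (F3_1 p).
  - apply: filterS goodP => w gw p.
    rewrite /F3; have [//|y yC ->] := telE id w p gw.
    rewrite -(real_normK (num_real y)) in yC.
    have := xx0 w; have := sqr_ge0 (`|y| - 1); rewrite /dom; nra.
  - apply: filterS goodP => w gw.
    rewrite /workload -WE; apply: (lim2 id) => // t; exact: cvg_id.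
split => //.
have s2E : comb_variance c = \sum_(i < n) omega i ^+ 2 * sigma i ^+ 2.
  by apply: eq_bigr => i _; rewrite exprMn.
rewrite -(fineK fin1) -(fineK fin2) -(fineK fin3) -/mu -s2E -!EFinM -EFinB; congr _%:E.
(* Both sides are limits of the same real sequence: the means of the trapezoids, rewritten by the
   grid identity. *)
apply: (cvg_unique _ cvg1) => //=; rewrite (funext F_E).
by apply: cvgB; apply: cvgM => //; exact: cvg_cst.
Qed.
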